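(* Let $n\ge 1$. The maps $\Phi$ and $\Psi$ are inverse bijections between triangulations of the once-punctured disc $S_n^1$ and $n$-periodic triangulations of the strip $\mathcal{U}_n$.
   Context: Once-punctured disc: $S_n^1$ is a closed disc with $n$ marked points on the boundary, labeled $1,\dots,n$ in clockwise order, and one interior marked point, the puncture, labeled $0$. An arc in $S_n^1$ is (the isotopy class of) a non-self-intersecting curve connecting two marked points (possibly equal) and not isotopic to a boundary segment between neighboring marked points. The arcs are the bridging arcs $0j$ connecting the puncture with $j$, and the peripheral arcs $ij$ ($i=j$ allowed), where $ij$ is the arc isotopic to the boundary segment going clockwise from $i$ to $j$ when all boundary marked points other than $i,j$ are ignored. A triangulation of $S_n^1$ is a maximal collection of arcs that pairwise do not meet in the interior (away from the puncture). $A(S_n^1)$ is the set of arcs of $S_n^1$ (labels of marked points are fixed; triangulations are not identified under rotation). Strip: $\mathcal{U}_n$ is $\mathbb{R}\times$ (closed interval) with vertices $0^{(k)}$, $k\in\mathbb{Z}$, on the upper boundary and vertices $1^{(k)},\dots,n^{(k)}$, $k\in\mathbb{Z}$, on the lower boundary, ordered from left to right on the lower boundary by: $i^{(k)}\le j^{(l)}$ iff $k<l$, or $k=l$ and $i\le j$; the vertices $0^{(k)}$ are ordered from left to right by $k$, with $0^{(k)}$ above $1^{(k)},\dots,n^{(k)}$. An arc in $\mathcal{U}_n$ is (the isotopy class of) a non-self-intersecting curve connecting two vertices such that (A1) at least one vertex is on the lower boundary; (A2) the two vertices are neither equal nor neighbors; (A3) if one vertex is on the upper boundary, the superscripts of the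 two vertices are equal. The arcs are thus bridging arcs $0^{(k)}j^{(k)}$ and peripheral arcs $i^{(k)}j^{(l)}$ (left endpoint $i^{(k)}$, right endpoint $j^{(l)}$). A triangulation of $\mathcal{U}_n$ is a maximal collection of arcs that pairwise do not meet in the interior of $\mathcal{U}_n$. It is $n$-periodic if it has a fundamental domain: an $(n+3)$-gon $\mathcal{P}$ in it such that the triangulation is covered by iteratively translating $\mathcal{P}$ in both horizontal directions. Explicitly, $\mathcal{P}$ has vertices $0^{(k)},0^{(k+1)}$ and $i^{(k)},(i+1)^{(k)},\dots,n^{(k)},1^{(k+1)},\dots,i^{(k+1)}$ for some $i\in\{1,\dots,n\}$, $k\in\mathbb{Z}$, is bounded on the sides by the bridging arcs $0^{(k)}i^{(k)}$ and $0^{(k+1)}i^{(k+1)}$ of the triangulation, and the triangulation is the union of the horizontal translates of its part in $\mathcal{P}$ under the shifts of superscripts $(k)\mapsto(k+m)$, $m\in\mathbb{Z}$. $A(\mathcal{U}_n)$ is the set of arcs of $\mathcal{U}_n$. The map $\Phi$: for $k\in\mathbb{Z}$ define $\iota_k:A(S_n^1)\to A(\mathcal{U}_n)$ by $\iota_k(ij)=i^{(k)}j^{(k)}$ if $i<j$ (including $i=0$) and $\iota_k(ij)=i^{(k)}j^{(k+1)}$ if $i\ge j$. For a triangulation $\Pi$ of $S_n^1$, $\Phi(\Pi)=\bigcup_{k\in\mathbb{Z}}\iota_k(\Pi)$. The map $\Psi$: for an $n$-periodic triangulation $\mathcal{T}_n$ of $\mathcal{U}_n$, every arc $i^{(k)}j^{(l)}$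 of $\mathcal{T}_n$ satisfies either $l=k$ and $i<j$, or $l=k+1$ and $i\ge j$; put $\pi(i^{(k)}j^{(l)})=ij$. Then $\Psi(\mathcal{T}_n)$ is the set of all $\pi(\gamma)$ for arcs $\gamma\in\mathcal{T}_n$ lying in a fundamental domain $\mathcal{P}$ (including its bounding arcs); this does not depend on the choice of $\mathcal{P}$. *)

(* Defs.v *)
From HB Require Import structures.
From mathcomp Require Import all_boot all_order all_algebra.
From mathcomp Require Import all_classical all_reals all_analysis.

Set Implicit Arguments.
Unset Strict Implicit.
Unset Printing Implicit Defensive.

Import Order.TTheory GRing.Theory Num.Theory.
Import numFieldNormedType.Exports.

Local Open Scope classical_set_scope.
Local Open Scope ring_scope.

(* The element i : 'I_n stands for the boundary vertex with label i.+1, so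
   that the vertices 1, ..., n of the disc or of the strip are indexed by
   0, ..., n.-1, in the same order.  Curves are maps R -> R * R considered on
   [0, 1]. *)

Section Curves.
Variable R : realType.
Implicit Types (g : R -> R * R) (S : set (R * R)).

(* Only the two endpoints of a curve are allowed to coincide. *)
Definition simple_curve g : Prop :=
  {within `[0, 1], continuous g} /\
  (forall s t : R, 0 <= s -> s < t -> t <= 1 -> g s = g t -> s = 0 /\ t = 1).

Definition simple_curve_from_to g (p q : R * R) : Prop :=
  [/\ simple_curve g, g 0 = p & g 1 = q].

(* Isotopy within S through simple curves, with fixed endpoints. *)
Definition isotopic_in S g0 g1 : Prop :=
  exists H : R * R -> R * R,
    [/\ {within `[0, 1] `*` `[0, 1], continuous H},
        (forall t, 0 <= t <= 1 -> H (0, t) = g0 t),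
        (forall t, 0 <= t <= 1 -> H (1, t) = g1 t),
        (forall s, 0 <= s <= 1 ->
           simple_curve_from_to (fun t => H (s, t)) (g0 0) (g0 1)) &
        (forall s t, 0 <= s <= 1 -> 0 <= t <= 1 -> S (H (s, t)))].

(* Two arcs, given as classes rep a and rep b of curves, do not meet in S if
   they have representatives that do not meet in S. *)
Definition do_not_meet (A : Type) (rep : A -> set (R -> R * R)) S (a b : A) :
    Prop :=
  exists g h, [/\ rep a g, rep b h &
    (g @` `[0, 1]) `&` (h @` `[0, 1]) `&` S = set0].

End Curves.

Section MaximalCollections.
Variables (A : Type) (arcs : set A) (compatible : A -> A -> Prop).

Definition compatible_collection (T : set A) : Prop :=
  T `<=` arcs /\ (forall a b, T a -> T b -> a <> b -> compatible a b).

Definition maximal_compatible_collection (T : set A) : Prop :=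
  compatible_collection T /\
  (forall T', compatible_collection T' -> T `<=` T' -> T' = T).

End MaximalCollections.

Section Disc.
Variables (R : realType) (n : nat).

Inductive disc_arc := DBridge of 'I_n | DPeriph of 'I_n & 'I_n.

(* The peripheral label ij is an arc unless it is the boundary segment from i
   to its clockwise neighbour, which is i itself if n = 1. *)
Definition disc_arcs : set disc_arc :=
  [set a | match a with DBridge _ => True | DPeriph i j => j <> ordS i end].

Definition sqnorm (p : R * R) : R := p.1 ^+ 2 + p.2 ^+ 2.

(* The disc is the closed unit disc, punctured at the origin. *)
Definition puncture : R * R := (0, 0).
Definition punctured_disc : set (R * R) := [set p | 0 < sqnorm p <= 1].
Definition punctured_disc_interior : set (R * R) :=
  [set p | 0 < sqnorm p < 1].

(* The boundary circle, parametrized clockwise with period n. *)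
Definition circle_pt (u : R) : R * R :=
  (cos (2 * pi * u / n%:R), - sin (2 * pi * u / n%:R)).

Definition disc_vertex (i : 'I_n) : R * R := circle_pt (i.+1)%:R.

Definition clockwise_steps (i j : 'I_n) : nat :=
  if (i < j)%N then (j - i)%N else (j + n - i)%N.

(* The path along the boundary going clockwise from i to j (once around the
   circle if i = j). *)
Definition boundary_path (i j : 'I_n) (t : R) : R * R :=
  circle_pt ((i.+1)%:R + t * (clockwise_steps i j)%:R).

(* All simple curves from the puncture to a given vertex are isotopic. *)
Definition disc_representative (a : disc_arc) : set (R -> R * R) :=
  [set g | (forall t, 0 < t < 1 -> punctured_disc_interior (g t)) /\
    match a with
    | DBridge j => simple_curve_from_to g puncture (disc_vertex j)
    | DPeriph i j =>
        simple_curve_from_to g (disc_vertex i) (disc_vertex j) /\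
        isotopic_in punctured_disc g (boundary_path i j)
    end].

Definition disc_triangulation : set (set disc_arc) :=
  maximal_compatible_collection disc_arcs
    (do_not_meet disc_representative punctured_disc_interior).

End Disc.

Arguments DBridge {n}.
Arguments DPeriph {n}.

Section Strip.
Variables (R : realType) (n : nat).

(* Upper k is 0^(k) and Lower k i is i^(k). *)
Inductive strip_vertex := Upper of int | Lower of int & 'I_n.

(* SBridge k j is 0^(k) j^(k), in accordance with (A1) and (A3), and
   SPeriph k i l j is i^(k) j^(l). *)
Inductive strip_arc :=
  | SBridge of int & 'I_n
  | SPeriph of int & 'I_n & int & 'I_n.

Definition left_end (a : strip_arc) : strip_vertex :=
  match a with SBridge k _ => Upper k | SPeriph k i _ _ => Lower k i end.
Definition right_end (a : strip_arc) : strip_vertex :=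
  match a with SBridge k j => Lower k j | SPeriph _ _ l j => Lower l j end.

Definition lower_lt (k : int) (i : 'I_n) (l : int) (j : 'I_n) : bool :=
  (k < l) || (k == l) && (i < j)%N.

Definition lower_neighbours (k : int) (i : 'I_n) (l : int) (j : 'I_n) : Prop :=
  lower_lt k i l j /\
  ~ (exists m h, lower_lt k i m h /\ lower_lt m h l j).

Definition strip_arcs : set strip_arc :=
  [set a | match a with
    | SBridge _ _ => True
    | SPeriph k i l j => lower_lt k i l j /\ ~ lower_neighbours k i l j
    end].

(* The strip is R x [0, 1]. *)
Definition strip_interior : set (R * R) := [set p | 0 < p.2 < 1].

Definition strip_point (v : strip_vertex) : R * R :=
  match v with
  | Upper k => (k%:~R + 1 / 2, 1)
  | Lower k i => (k%:~R + (i.+1)%:R / (n.+1)%:R, 0)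
  end.

(* The strip is simply connected, so the endpoints determine an isotopy
   class. *)
Definition strip_representative (a : strip_arc) : set (R -> R * R) :=
  [set g | (forall t, 0 < t < 1 -> strip_interior (g t)) /\
    simple_curve_from_to g (strip_point (left_end a))
                           (strip_point (right_end a))].

Definition strip_triangulation : set (set strip_arc) :=
  maximal_compatible_collection strip_arcs
    (do_not_meet strip_representative strip_interior).

Definition shift_arc (m : int) (a : strip_arc) : strip_arc :=
  match a with
  | SBridge k j => SBridge (k + m) j
  | SPeriph k i l j => SPeriph (k + m) i (l + m) j
  end.

(* The vertices of the (n+3)-gon with corners 0^(k), 0^(k+1), i^(k), i^(k+1),
   which is encoded by the pair (k, i). *)
Definition polygon_vertex (P : int * 'I_n) (v : strip_vertex) : Prop :=
  match v with
  | Upper l => l = P.1 \/ l = P.1 + 1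
  | Lower l j => l = P.1 /\ (P.2 <= j)%N \/ l = P.1 + 1 /\ (j <= P.2)%N
  end.

Definition in_polygon (P : int * 'I_n) : set strip_arc :=
  [set a | polygon_vertex P (left_end a) /\ polygon_vertex P (right_end a)].

Definition fundamental_domain (T : set strip_arc) (P : int * 'I_n) : Prop :=
  [/\ T (SBridge P.1 P.2), T (SBridge (P.1 + 1) P.2) &
      T = \bigcup_(m in [set: int]) (shift_arc m @` (T `&` in_polygon P))].

Definition periodic_strip_triangulation : set (set strip_arc) :=
  [set T | strip_triangulation T /\ exists P, fundamental_domain T P].

End Strip.

Arguments SBridge {n}.
Arguments SPeriph {n}.

Section Maps.
Variable n : nat.

Definition iota_arc (k : int) (a : disc_arc n) : strip_arc n :=
  match a with
  | DBridge j => SBridge k j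
  | DPeriph i j => if (i < j)%N then SPeriph k i k j else SPeriph k i (k + 1) j
  end.

Definition Phi (Pi : set (disc_arc n)) : set (strip_arc n) :=
  \bigcup_(k in [set: int]) (iota_arc k @` Pi).

(* Only meaningful on arcs i^(k) j^(l) with l = k and i < j, or l = k + 1 and
   i >= j; all arcs in a polygon are of this form. *)
Definition proj_arc (a : strip_arc n) : disc_arc n :=
  match a with SBridge _ j => DBridge j | SPeriph _ i _ j => DPeriph i j end.

Definition Psi_at (P : int * 'I_n) (T : set (strip_arc n)) :
    set (disc_arc n) :=
  proj_arc @` (T `&` in_polygon P).

(* Equal to Psi_at P T for every single fundamental domain P of a periodic
   triangulation T. *)
Definition Psi (T : set (strip_arc n)) : set (disc_arc n) :=
  \bigcup_(P in fundamental_domain T) Psi_at P T.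

End Maps.

(* Main.v *)
(* Sending the vertex i^(k) to the integer k n + i turns peripheral arcs of the
   strip into integer intervals and bridging arcs into integers, and a disc arc
   into an orbit under translation by n.  Topological compatibility amounts to
   combinatorial non-crossing:
   - arcs that do not cross are realized disjointly by parabolas with a common
     leading coefficient and by straight segments; wrapping the parabolas
     around the puncture gives the disc arcs;
   - if two crossing curves g, h in the strip did not meet, then g(s) - h(t)
     would be a nowhere vanishing map on the unit square, hence would have a
     continuous angle, but that angle changes by -2 pi along the boundary.  In
     the disc the same argument applies to the lifts of the curves to the
     universal cover, where the isotopy to the boundary path determines the
     endpoints of the lift of a peripheral arc.
   A triangulation of the disc contains a bridging arc, at an endpoint of a
   longest peripheral arc.  So a maximal non-crossing set in the strip
   containing Phi Pi has no peripheral arc longer than n, that is, no arc that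
   does not come from the disc. *)

Require Import Defs.
From HB Require Import structures.
From mathcomp Require Import all_boot all_order all_algebra.
From mathcomp Require Import all_classical all_reals all_analysis.
From mathcomp Require Import ring lra zify.

Set Implicit Arguments.
Unset Strict Implicit.
Unset Printing Implicit Defensive.

Import Order.TTheory GRing.Theory Num.Theory.
Import numFieldNormedType.Exports.

Local Open Scope classical_set_scope.

(** * Continuous angles of plane maps *)

Section AngleLifting.
Local Open Scope ring_scope.
Variable R : realType.
Implicit Types (z w : R * R) (t u v : R).

Definition polar t z : Prop := exists2 r, 0 < r & z = (r * cos t, r * sin t).

Definition dot z w : R := z.1 * w.1 + z.2 * w.2.
Definition cross z w : R := z.1 * w.2 - z.2 * w.1.

(** An acute angle from [z] to [w] is the arctangent of [cross z w / dot z w], a formula that is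
    continuous in both vectors. *)
Lemma polar_step t z w : polar t z -> 0 < dot z w ->
  polar (t + atan (cross z w / dot z w)) w.
Proof.
move=> [r r0 ->]; rewrite /dot /cross /=; set c := cos t; set s := sin t => d0.
set D := (X in 0 < X) in d0 *; set C := (X in X / D).
have /andP[h1 h2] : - (pi / 2) < atan (C / D) < pi / 2.
  by rewrite atan_gtNpi2 atan_ltpi2.
have cd : 0 < cos (atan (C / D)) by apply: cos_gt0_pihalf; rewrite h1 h2.
have sd : sin (atan (C / D)) = C / D * cos (atan (C / D)).
  have := atanK (C / D); rewrite {1}/tan => /(congr1 ( *%R^~ (cos (atan (C / D))))).
  by rewrite /= mulfVK // gt_eqF.
have cs : c ^+ 2 + s ^+ 2 = 1 by exact: cos2Dsin2.
(* This is the norm of [w]: [D] is [r] times that norm times the cosine of the angle between the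
   vectors. *)
exists (D / r / cos (atan (C / D))); first by rewrite !divr_gt0.
rewrite cosD sinD sd -/c -/s; set k := cos _ in cd *.
have -> : w = (w.1 * (c ^+ 2 + s ^+ 2), w.2 * (c ^+ 2 + s ^+ 2)).
  by rewrite cs !mulr1; case: (w).
congr pair.
- transitivity ((D * c - C * s) / r); last by field; rewrite !gt_eqF.
  by rewrite /D /C; field; rewrite gt_eqF.
- transitivity ((D * s + C * c) / r); last by field; rewrite !gt_eqF.
  by rewrite /D /C; field; rewrite gt_eqF.
Qed.

(** Every nonzero vector makes an acute angle with one of the four unit vectors on the axes, whose
    angles are known. *)
Lemma polar_exists z : z != (0, 0) -> exists t, polar t z.
Proof.
have step t w : polar t w -> 0 < dot w z -> exists t, polar t z.
  by move=> tw wz; eexists; exact: polar_step tw wz.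
have p0 : polar 0 (1, 0).
  by exists 1 => //; rewrite cos0 sin0 mulr1 mulr0.
have p1 : polar (pi / 2) (0, 1).
  by exists 1 => //; rewrite cos_pihalf sin_pihalf mulr1 mulr0.
have p2 : polar pi (-1, 0).
  by exists 1 => //; rewrite cospi sinpi mulr0 mul1r.
have p3 : polar (- (pi / 2)) (0, -1).
  by exists 1 => //; rewrite cosN sinN cos_pihalf sin_pihalf mulr0 mul1r.
case: z step => a b step; rewrite xpair_eqE negb_and => ab.
case: (ltgtP a 0) ab => [a0 _|a0 _|_ /=].
- by apply: step p2 _; rewrite /dot /=; lra.
- by apply: step p0 _; rewrite /dot /=; lra.
case: (ltgtP b 0) => // b0 _.
- by apply: step p3 _; rewrite /dot /=; lra.
- by apply: step p1 _; rewrite /dot /=; lra.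
Qed.

Lemma polar_uniq t u z : polar t z -> polar u z ->
  cos (t - u) = 1 /\ sin (t - u) = 0.
Proof.
move=> [r r0 ->] [q q0 []]; rewrite cosB sinB => E1 E2.
have := cos2Dsin2 t; have := cos2Dsin2 u.
move: (cos t) (sin t) (cos u) (sin u) E1 E2 => a b c d E1 E2 h1 h2.
have e : r = q.
  apply/eqP; rewrite -(@eqrXn2 _ 2) //; try exact: ltW.
  apply/eqP; transitivity ((r * a) ^+ 2 + (r * b) ^+ 2).
    by rewrite !exprMn -mulrDr h2 mulr1.
  by rewrite E1 E2 !exprMn -mulrDr h1 mulr1.
subst q; have rn : r != 0 by rewrite gt_eqF.
have -> := mulfI rn E1; have -> := mulfI rn E2.
by split; [rewrite -!expr2|rewrite mulrC subrr].
Qed.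

(** The retraction of the line onto [[0, 1]]; composing with it turns continuity within the interval
    into continuity everywhere. *)
Definition clamp t : R := Num.max 0 (Num.min 1 t).

Lemma clamp_itv t : 0 <= clamp t <= 1.
Proof. by rewrite /clamp le_max ge_max ge_min !lexx ler01. Qed.

Lemma clamp_id t : 0 <= t <= 1 -> clamp t = t.
Proof. by case/andP => t0 t1; rewrite /clamp min_r // max_r. Qed.

Lemma continuous_clamp : continuous clamp.
Proof.
move=> x; apply: (@continuous_max _ _ (cst 0) (fun t => Num.min 1 t)).
  exact: cvg_cst.
by apply: (@continuous_min _ _ (cst 1) id); [exact: cvg_cst|exact: cvg_id].
Qed.

Lemma continuous_comp_within (T U V : topologicalType) (A : set U)
    (c : T -> U) (f : U -> V) :
  continuous c -> (forall x, A (c x)) -> {within A, continuous f} ->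
  continuous (f \o c).
Proof.
move=> cc cA /subspace_continuousP cf x.
apply: cvg_comp (cf _ (cA x)) => W; rewrite /within /= !nbhs_simpl => /cc.
rewrite nbhs_simpl /=; apply: filterS => y; exact.
Qed.

Lemma continuous_pair (T U V : topologicalType) (f : T -> U) (g : T -> V) :
  continuous f -> continuous g -> continuous (fun x => (f x, g x)).
Proof. by move=> cf cg x; apply: cvg_pair; [exact: cf|exact: cg]. Qed.

Lemma continuous_proj1 (T U V : topologicalType) (f : T -> U * V) :
  continuous f -> continuous (fun x => (f x).1).
Proof. by move=> cf x; apply: continuous_comp; [exact: cf|exact: cvg_fst]. Qed.

Lemma continuous_proj2 (T U V : topologicalType) (f : T -> U * V) :
  continuous f -> continuous (fun x => (f x).2).
Proof. by move=> cf x; apply: continuous_comp; [exact: cf|exact: cvg_snd]. Qed.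

Definition unit_square : set (R * R) := `[0, 1] `*` `[0, 1].

Lemma unit_squareE s t : unit_square (s, t) = (0 <= s <= 1 /\ 0 <= t <= 1) :> Prop.
Proof. by rewrite /unit_square /setX /= !in_itv. Qed.

Lemma continuous_dot (T : topologicalType) (f g : T -> R * R) :
  continuous f -> continuous g -> continuous (fun x => dot (f x) (g x)).
Proof.
move=> cf cg x; rewrite /dot.
by apply: cvgD; apply: cvgM;
  (apply: continuous_proj1 || apply: continuous_proj2).
Qed.

Lemma continuous_cross (T : topologicalType) (f g : T -> R * R) :
  continuous f -> continuous g -> continuous (fun x => cross (f x) (g x)).
Proof.
move=> cf cg x; rewrite /cross.
by apply: cvgB; apply: cvgM;
  (apply: continuous_proj1 || apply: continuous_proj2).
Qed.

Lemma dot_gt0 z : z != (0, 0) -> 0 < dot z z.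
Proof.
case: z => a b; rewrite xpair_eqE negb_and /dot /= => /orP[] h.
  by rewrite -!expr2 ltr_pwDl // ?sqr_ge0 // exprn_even_gt0.
by rewrite -!expr2 ltr_wpDl // ?sqr_ge0 // exprn_even_gt0.
Qed.

(** Continuity gives a positive [dot] for any two points near a given one; compactness of the square
    makes the radius uniform. *)
Lemma uniform_dot_gt0 (F : R * R -> R * R) :
  continuous F -> (forall p, F p != (0, 0)) ->
  exists2 e, 0 < e & forall p q, unit_square p ->
    `|p - q| < e -> 0 < dot (F p) (F q).
Proof.
move=> cF F0.
have cK : compact unit_square by apply: compact_setX; exact: segment_compact.
have /compact_near_coveringP/(_ R (nbhs (0:R)^'+)
   (fun e p => forall q, `|p - q| < e -> 0 < dot (F p) (F q))) := cK.
move=> /(_ _ _)[].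
  move=> x _.
  have cD : {for (x, x), continuous (fun w : (R * R) * (R * R) => dot (F w.1) (F w.2))}.
    apply: (@continuous_dot _ (F \o fst) (F \o snd)) => w.
      by apply: continuous_comp; [exact: cvg_fst|exact: cF].
    by apply: continuous_comp; [exact: cvg_snd|exact: cF].
  have /nbhs_ballP[r /= r0 br] :
      nbhs (x, x) [set w : (R * R) * (R * R) | 0 < dot (F w.1) (F w.2)].
    exact: (cvgr_gt _ cD _ (dot_gt0 (F0 x))).
  exists (ball x (r / 2), [set e | e < r / 2]) => /=.
    split; first by apply: nbhsx_ballx; rewrite divr_gt0.
    by apply: nbhs_right_lt; rewrite divr_gt0.
  move=> [x' e] /= [bx er] q qe; apply: (br (x', q)); split => /=.
    by apply: le_ball bx; lra.
  have bq : ball x' (r / 2) q by rewrite -ball_normE /=; exact: lt_trans er.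
  by rewrite [r]splitr; exact: ball_triangle bx bq.
move=> e /= e0 he; exists (e / 2); first by rewrite divr_gt0.
move=> p q Kp pq; apply: (he (e / 2)) => //=; last by rewrite divr_gt0.
by rewrite sub0r normrN gtr0_norm; lra.
Qed.

(* Along the ray from the origin to p, F is sampled so finely that successive
   values make an acute angle; the angles add up to an angle of F p. *)
Theorem angle_lifting (F : R * R -> R * R) :
  {within unit_square, continuous F} ->
  (forall p, unit_square p -> F p != (0, 0)) ->
  exists2 th : R * R -> R, continuous th &
    forall p, unit_square p -> polar (th p) (F p).
Proof.
move=> cF F0; pose cl (p : R * R) := (clamp p.1, clamp p.2).
have clK p : unit_square (cl p) by rewrite unit_squareE; split; exact: clamp_itv.
have ccl : continuous cl.
  by apply: continuous_pair => x; apply: continuous_comp;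
    [exact: cvg_fst|exact: continuous_clamp|exact: cvg_snd|exact: continuous_clamp].
have cG := continuous_comp_within ccl clK cF; set G := F \o cl in cG.
have G0 p : G p != (0, 0) by apply: F0.
have [e e0 he] := uniform_dot_gt0 cG G0.
have [N hN] := ltr_add_invr e0; rewrite add0r in hN.
pose pt (k : nat) (p : R * R) := (k%:R / N.+1%:R * clamp p.1, k%:R / N.+1%:R * clamp p.2).
have cpt k : continuous (pt k).
  apply: continuous_pair => x; (apply: cvgM; first exact: cvg_cst);
    apply: continuous_comp; first [exact: cvg_fst|exact: cvg_snd|exact: continuous_clamp].
have kN k : (k <= N.+1)%N -> 0 <= (k%:R / N.+1%:R : R) <= 1.
  move=> kN; apply/andP; split; first by rewrite divr_ge0.
  by rewrite ler_pdivrMr ?ltr0n // mul1r ler_nat.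
have pt_sq k p : (k <= N.+1)%N -> unit_square (pt k p).
  move=> /kN /andP[k0 k1]; rewrite unit_squareE.
  have [/andP[a0 a1] /andP[b0 b1]] := (clamp_itv p.1, clamp_itv p.2).
  by split; rewrite mulr_ge0 //= mulr_ile1.
have pt_close k p : `|pt k p - pt k.+1 p| < e.
  apply: le_lt_trans hN; rewrite prod_normE /= -!mulrBl -(natr1 k).
  rewrite opprD addNKr mulN1r !normrM !normrN normfV normr_nat ge_max.
  have h t : `|clamp t| <= 1.
    by have /andP[t0 t1] := clamp_itv t; rewrite ger0_norm.
  by rewrite !ler_piMr.
have dot_pos k p : (k < N.+1)%N -> 0 < dot (G (pt k p)) (G (pt k.+1 p)).
  by move=> kN'; apply: he => //; apply: pt_sq; exact: ltnW.
have [t0 ht0] := polar_exists (G0 (0, 0)).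
pose st k p := atan (cross (G (pt k p)) (G (pt k.+1 p)) / dot (G (pt k p)) (G (pt k.+1 p))).
exists (fun p => t0 + \sum_(k < N.+1) st k p).
  move=> p; apply: cvgD; first exact: cvg_cst.
  apply: (cvg_big add_continuous) => // k _; rewrite /st.
  have cGp j : continuous (G \o pt j).
    by move=> q; apply: continuous_comp; [exact: cpt|exact: cG].
  apply: (@continuous_comp _ _ _ (fun q => cross (G (pt k q)) (G (pt k.+1 q)) /
    dot (G (pt k q)) (G (pt k.+1 q))) (@atan R)); last exact: continuous_atan.
  apply: cvgM; first exact: (continuous_cross (cGp k) (cGp k.+1)).
  apply: cvgV; first by rewrite gt_eqF // dot_pos.
  exact: (continuous_dot (cGp k) (cGp k.+1)).
move=> p Kp.
have <- : G (pt N.+1 p) = F p.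
  rewrite /G /pt /= divff ?pnatr_eq0 // !mul1r /cl /=.
  case: p Kp => x y; rewrite unit_squareE => -[hx hy] /=.
  by rewrite !clamp_id.
suff H m : (m <= N.+1)%N -> polar (t0 + \sum_(k < m) st k p) (G (pt m p)).
  exact: H.
elim: m => [_|m IH mN].
  by rewrite big_ord0 addr0 /pt !mul0r.
rewrite big_ord_recr /= addrA; apply: polar_step; first exact/IH/ltnW.
exact: dot_pos.
Qed.

End AngleLifting.

(** * Curves that have to meet *)

Section Crossing.
Local Open Scope ring_scope.
Variable R : realType.
Implicit Types (z : R * R) (t u : R).

Lemma polar_upper t z : polar t z -> 0 <= z.2 -> 0 <= sin t.
Proof. by move=> [r r0 ->] /=; rewrite pmulr_rge0. Qed.

Lemma polar_lower t z : polar t z -> z.2 <= 0 -> sin t <= 0.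
Proof. by move=> [r r0 ->] /=; rewrite pmulr_rle0. Qed.

Lemma polar_pos t z : polar t z -> 0 < z.1 -> z.2 = 0 -> cos t = 1 /\ sin t = 0.
Proof.
move=> [r r0 ->] /=; rewrite pmulr_rgt0 // => c0 /eqP.
rewrite mulf_eq0 gt_eqF //= => /eqP s0; split=> //.
by rewrite -(gtr0_norm c0); exact: sin0cos1.
Qed.

Lemma polar_neg t z : polar t z -> z.1 < 0 -> z.2 = 0 -> cos t = -1 /\ sin t = 0.
Proof.
move=> [r r0 ->] /=; rewrite pmulr_rlt0 // => c0 /eqP.
rewrite mulf_eq0 gt_eqF //= => /eqP s0; split=> //.
by apply: oppr_inj; rewrite opprK -(ltr0_norm c0); exact: sin0cos1.
Qed.

(** Past [b + pi], the intermediate value theorem would give a value of [f] strictly between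
    [b + pi] and [b + 2 pi], where the sine is negative. *)
Lemma trapped_le (f : R -> R) b u : continuous f ->
  (forall t, 0 <= t <= 1 -> 0 <= sin (f t - b)) ->
  0 <= u <= 1 -> f u <= b + pi -> forall t, 0 <= t <= 1 -> f t <= b + pi.
Proof.
move=> cf fs u01 fu t t01; rewrite leNgt; apply/negP => ft.
have pi0 : 0 < pi :> R := pi_gt0 R.
(* The cap at [b + 3 pi / 2] keeps [v] below [b + 2 pi], however large [f t] is. *)
pose v := Num.min (f t) (b + pi + pi / 2).
have vle : v <= f t by rewrite ge_min lexx.
have vgt : b + pi < v by rewrite lt_min ft /= ltrDl divr_gt0.
have vlt : v < b + pi + pi.
  apply: (@le_lt_trans _ _ (b + pi + pi / 2)); first by rewrite ge_min lexx orbT.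
  lra.
have [c c01 fc] : exists2 c, 0 <= c <= 1 & f c = v.
  have fuv : f u <= v by lra.
  have [ut|tu] := leP u t.
    have [|c] := @IVT R f u t v ut (continuous_subspaceT cf).
      by rewrite ge_min fuv /= le_max vle orbT.
    by rewrite in_itv /= => cut fc; exists c => //; lra.
  have [|c] := @IVT R f t u v (ltW tu) (continuous_subspaceT cf).
    by rewrite ge_min fuv orbT /= le_max vle.
  by rewrite in_itv /= => cut fc; exists c => //; lra.
have := fs c c01; rewrite fc.
have -> : v - b = v - b - pi + pi by ring.
rewrite sinDpi oppr_ge0 leNgt => /negP; apply.
by apply: sin_gt0_pi; lra.
Qed.

(** As long as a vector stays in a closed half-plane, its continuous angle cannot leave one
    half-turn. The lower bound is the upper one for [- f], based at [- (b + pi)]. *)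
Lemma trapped (f : R -> R) b u : continuous f ->
  (forall t, 0 <= t <= 1 -> 0 <= sin (f t - b)) ->
  0 <= u <= 1 -> b <= f u <= b + pi ->
  forall t, 0 <= t <= 1 -> b <= f t <= b + pi.
Proof.
move=> cf fs u01 /andP[ub1 ub2] t t01; apply/andP; split; last first.
  exact: (trapped_le cf fs u01).
have H := @trapped_le (fun t => - f t) (- (b + pi)) u _ _ u01.
suff : - f t <= - (b + pi) + pi by lra.
apply: H => //; last by lra.
  by move=> x; apply: cvgN; exact: cf.
move=> s /fs; rewrite (_ : - f s - - (b + pi) = - (f s - b) + pi); last by ring.
by rewrite sinDpi sinN opprK.
Qed.

Definition neg_axis z := z.1 < 0 /\ z.2 = 0.
Definition pos_axis z := 0 < z.1 /\ z.2 = 0.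

(* An angle of F would decrease by pi along the bottom edge, and by pi again
   along the rest of the boundary, traversed in the same direction. *)
Lemma no_winding (F : R * R -> R * R) :
  {within @unit_square R, continuous F} ->
  (forall p, unit_square p -> F p != (0, 0)) ->
  neg_axis (F (0, 0)) -> pos_axis (F (1, 0)) ->
  (forall s, 0 <= s <= 1 -> 0 <= (F (s, 0)).2) ->
  (forall t, 0 <= t <= 1 -> (F (0, t)).2 <= 0) ->
  (forall t, 0 <= t <= 1 -> (F (1, t)).2 <= 0) ->
  (forall s, 0 <= s <= 1 -> (F (s, 1)).2 <= 0) \/
    [/\ neg_axis (F (0, 1)), neg_axis (F (1, 1)) &
      forall s, 0 <= s <= 1 -> 0 <= (F (s, 1)).2] ->
  False.
Proof.
move=> cF F0 [n1 n2] [p1 p2] up lo0 lo1 top.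
have [th cth thF] := angle_lifting cF F0.
have pi0 : 0 < pi :> R := pi_gt0 R.
have i0 : 0 <= (0 : R) <= 1 by rewrite lexx ler01.
have i1 : 0 <= (1 : R) <= 1 by rewrite lexx ler01.
have thp s t : 0 <= s <= 1 -> 0 <= t <= 1 -> polar (th (s, t)) (F (s, t)).
  by move=> ? ?; apply: thF; rewrite unit_squareE.
pose b := th (1, 0).
have [cb sb] := polar_pos (thp _ _ i1 i0) p1 p2.
have sinb x : sin (x - b) = sin x by rewrite sinB -/b cb sb mulr1 mulr0 subr0.
have sinb' x : sin (x - (b - pi)) = - sin x.
  by rewrite (_ : x - (b - pi) = x - b + pi); [rewrite sinDpi sinb|ring].
have sinb2 x : sin (x - (b - pi - pi)) = sin x.
  rewrite (_ : x - (b - pi - pi) = x - (b - pi) + pi); last by ring.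
  by rewrite sinDpi sinb' opprK.
have ch t : continuous (fun s => th (s, t)).
  move=> s; apply: (@continuous_comp _ _ _ (fun s => (s, t)) th); last exact: cth.
  by apply: (@continuous_pair _ _ _ id (cst t)) => ?; [exact: cvg_id|exact: cvg_cst].
have cv s : continuous (fun t => th (s, t)).
  move=> t; apply: (@continuous_comp _ _ _ (fun t => (s, t)) th); last exact: cth.
  by apply: (@continuous_pair _ _ _ (cst s) id) => ?; [exact: cvg_cst|exact: cvg_id].
have cosb x : cos (x - b) = cos x by rewrite cosB -/b cb sb mulr1 mulr0 addr0.
have E1 : b <= th (0, 0) <= b + pi.
  apply: (trapped (ch 0) _ i1 _ i0); last by rewrite -/b; lra.
  by move=> s s01; rewrite sinb (polar_upper (thp _ _ s01 i0)) // up.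
have E2 : forall t, 0 <= t <= 1 -> b - pi <= th (1, t) <= b - pi + pi.
  apply: (trapped (cv 1) _ i0); last by rewrite -/b; lra.
  by move=> t t01; rewrite sinb' oppr_ge0 (polar_lower (thp _ _ i1 t01)) // lo1.
(* The left edge stays in the lower half-plane, so an angle in [[b - pi, b]] anywhere on it carries
   over to the corner [(0, 0)]. With [E1] the angle there is [b], the direction of the positive
   axis, whereas [F (0, 0)] lies on the negative one. *)
have E0 u : 0 <= u <= 1 -> b - pi <= th (0, u) <= b - pi + pi -> False.
  move=> u01 hu.
  have hl : b - pi <= th (0, 0) <= b - pi + pi.
    apply: (trapped (cv 0) _ u01 hu i0).
    by move=> t t01; rewrite sinb' oppr_ge0 (polar_lower (thp _ _ i0 t01)) // lo0.
  have [c0 s0] := polar_neg (thp _ _ i0 i0) n1 n2.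
  have e : b = th (0, 0) by lra.
  by move: cb; rewrite -/b e c0; lra.
have cos_pi_inj x : 0 <= x <= pi -> cos x = -1 -> x = pi.
  move=> hx cx; apply: cos_inj; rewrite ?cospi // in_itv /= ?hx //.
  by rewrite lexx pi_ge0.
have h11 := E2 1 i1.
(* A top edge in the lower half-plane preserves the interval [[b - pi, b]]. In the other case the
   negative axis pins the angle at [(1, 1)] to [b - pi], the top edge confines it to
   [[b - 2 pi, b - pi]], and the corner [(0, 1)] pins it to [b - pi] again. *)
case: top => [lo|[m01 m11 hi]].
  apply: (E0 1 i1); apply: (trapped (ch 1) _ i1 h11 i0).
  by move=> s s01; rewrite sinb' oppr_ge0 (polar_lower (thp _ _ s01 i1)) // lo.
have [c11 _] := polar_neg (thp _ _ i1 i1) m11.1 m11.2.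
have [c01 _] := polar_neg (thp _ _ i0 i1) m01.1 m01.2.
have e11 : th (1, 1) = b - pi.
  have : - (th (1, 1) - b) = pi by apply: cos_pi_inj; rewrite ?cosN ?cosb //; lra.
  by lra.
have h01 : b - pi - pi <= th (0, 1) <= b - pi - pi + pi.
  apply: (trapped (ch 1) _ i1 _ i0); last by rewrite e11; lra.
  by move=> s s01; rewrite sinb2 (polar_upper (thp _ _ s01 i1)) // hi.
have e01 : th (0, 1) - b + pi + pi = pi.
  by apply: cos_pi_inj; [lra|rewrite !cosDpi opprK cosb].
by apply: (E0 1 i1); lra.
Qed.

Lemma continuous_within_unit (T : topologicalType) (f : R -> T) :
  {within `[0, 1], continuous f} -> continuous (f \o @clamp R).
Proof.
apply: continuous_comp_within; first exact: continuous_clamp.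
by move=> x /=; rewrite in_itv; exact: clamp_itv.
Qed.

Lemma continuous_sub_curves (G H : R -> R * R) :
  continuous G -> continuous H ->
  continuous (fun p : R * R => ((G p.1).1 - (H p.2).1, (G p.1).2 - (H p.2).2)).
Proof.
move=> cG cH; have cG1 : continuous (fun p : R * R => G p.1).
  by move=> p; apply: continuous_comp; [exact: cvg_fst|exact: cG].
have cH2 : continuous (fun p : R * R => H p.2).
  by move=> p; apply: continuous_comp; [exact: cvg_snd|exact: cH].
apply: continuous_pair => p; apply: cvgB.
- exact: continuous_proj1.
- exact: continuous_proj1.
- exact: continuous_proj2.
- exact: continuous_proj2.
Qed.

Let unit0 : 0 <= (0 : R) <= 1. Proof. by rewrite lexx ler01. Qed.
Let unit1 : 0 <= (1 : R) <= 1. Proof. by rewrite lexx ler01. Qed.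

(** [no_winding] applies to [G s - H t]: as [c] lies between the ends of [G], the bottom edge leads
    from the negative to the positive axis; as [d] lies to the right of both ends, the top edge
    falls under the second alternative. *)
Lemma crossing_arcs (G H : R -> R * R) (a b c d : R) :
  {within `[0, 1], continuous G} -> {within `[0, 1], continuous H} ->
  G 0 = (a, 0) -> G 1 = (b, 0) -> H 0 = (c, 0) -> H 1 = (d, 0) ->
  a < c < b -> b < d ->
  (forall t, 0 <= t <= 1 -> 0 <= (G t).2) ->
  (forall t, 0 <= t <= 1 -> 0 <= (H t).2) ->
  exists s t, [/\ 0 <= s <= 1, 0 <= t <= 1 & G s = H t].
Proof.
move=> /continuous_within_unit cG /continuous_within_unit cH.
move=> G0 G1 H0 H1 acb bd Gp Hp; apply: contrapT => nex.
have cF := continuous_sub_curves cG cH.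
apply: (no_winding (continuous_subspaceT cF)) => /=.
- case=> s t _ /=; apply/eqP => -[/eqP + /eqP]; rewrite !subr_eq0 => /eqP e1 /eqP e2.
  apply: nex; exists (clamp s), (clamp t); split; try exact: clamp_itv.
  by rewrite [LHS]surjective_pairing e1 e2 -surjective_pairing.
- by rewrite /neg_axis !clamp_id // G0 H0 /=; lra.
- by rewrite /pos_axis !clamp_id // G1 H0 /=; lra.
- by move=> s s01; rewrite !clamp_id // H0 subr0 Gp.
- by move=> t t01; rewrite !clamp_id // G0 sub0r oppr_le0 Hp.
- by move=> t t01; rewrite !clamp_id // G1 sub0r oppr_le0 Hp.
- right; split; last by move=> s s01; rewrite !clamp_id // H1 subr0 Gp.
    by rewrite /neg_axis !clamp_id // G0 H1 /=; lra.
  by rewrite /neg_axis !clamp_id // G1 H1 /=; lra.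
Qed.

(** [H] is run backwards, so that its foot [c] gives the bottom edge. On the top edge [G] is
    compared with [H 0], which is at least as high as all of [G]; this is the first alternative of
    [no_winding]. *)
Lemma crossing_bridge (G H : R -> R * R) (a b c : R) :
  {within `[0, 1], continuous G} -> {within `[0, 1], continuous H} ->
  G 0 = (a, 0) -> G 1 = (b, 0) -> H 1 = (c, 0) -> a < c < b ->
  (forall t, 0 <= t <= 1 -> 0 <= (G t).2 <= (H 0).2) ->
  (forall t, 0 <= t <= 1 -> 0 <= (H t).2) ->
  exists s t, [/\ 0 <= s <= 1, 0 <= t <= 1 & G s = H t].
Proof.
move=> /continuous_within_unit cG /continuous_within_unit cH.
move=> G0 G1 H1 acb Gp Hp; apply: contrapT => nex.
pose opp (t : R) := 1 - t.
have oppP t : 0 <= t <= 1 -> 0 <= opp t <= 1 by rewrite /opp; lra.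
have copp : continuous opp.
  by move=> t; apply: cvgB; [exact: cvg_cst|exact: cvg_id].
have cH' : continuous (H \o @clamp R \o opp).
  by move=> t; apply: continuous_comp; [exact: copp|exact: cH].
have cF := continuous_sub_curves cG cH'.
have [opp0 opp1] : opp 0 = 1 /\ opp 1 = 0 by rewrite /opp subr0 subrr.
apply: (no_winding (continuous_subspaceT cF)) => /=.
- case=> s t _ /=; apply/eqP => -[/eqP + /eqP]; rewrite !subr_eq0 => /eqP e1 /eqP e2.
  apply: nex; exists (clamp s), (clamp (opp t)); split; try exact: clamp_itv.
  by rewrite [LHS]surjective_pairing e1 e2 -surjective_pairing.
- by rewrite /neg_axis opp0 !clamp_id // G0 H1 /=; lra.
- by rewrite /pos_axis opp0 !clamp_id // G1 H1 /=; lra.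
- by move=> s s01; rewrite opp0 !clamp_id // H1 subr0; case/andP: (Gp _ s01).
- by move=> t t01; rewrite !clamp_id ?oppP // G0 sub0r oppr_le0 Hp ?oppP.
- by move=> t t01; rewrite !clamp_id ?oppP // G1 sub0r oppr_le0 Hp ?oppP.
- left=> s s01; rewrite opp1 !clamp_id // subr_le0.
  by case/andP: (Gp _ s01).
Qed.

End Crossing.

(** * Arcs of the strip *)

Section Combinatorics.
Local Open Scope ring_scope.
Variable n : nat.

Definition pos (k : int) (i : 'I_n) : int := k * n%:Z + (i : nat)%:Z.

Lemma lower_lt_pos k i l j : lower_lt k i l j = (pos k i < pos l j).
Proof.
rewrite /lower_lt /pos; have [hi hj] := (ltn_ord i, ltn_ord j).
case: (ltrgtP k l) => [kl|lk|->] /=; last by rewrite ltrD2l.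
  apply/esym; have : 0 <= (l - k - 1) * n%:Z by apply: mulr_ge0; lia.
  by rewrite !mulrBl mul1r; lia.
apply/esym/negbTE; have : 0 <= (k - l - 1) * n%:Z by apply: mulr_ge0; lia.
by rewrite !mulrBl mul1r; lia.
Qed.

Lemma pos_inj k i l j : pos k i = pos l j -> k = l /\ i = j.
Proof.
move=> e; have h1 : ~~ lower_lt k i l j by rewrite lower_lt_pos e ltxx.
have h2 : ~~ lower_lt l j k i by rewrite lower_lt_pos e ltxx.
move: h1 h2; rewrite /lower_lt !negb_or -!leNgt => /andP[lk h1] /andP[kl h2].
have kE : k = l by apply: le_anti; rewrite kl lk.
move: h1 h2; rewrite kE eqxx /= -!leqNgt => ji ij; split=> //.
by apply/val_inj/anti_leq; rewrite ij ji.
Qed.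

Lemma posD k i m : pos (k + m) i = pos k i + m * n%:Z.
Proof. by rewrite /pos mulrDl addrAC. Qed.

Lemma clockwise_steps_bounds (i j : 'I_n) : (0 < clockwise_steps i j <= n)%N.
Proof.
have hi := ltn_ord i; have hj := ltn_ord j.
by rewrite /clockwise_steps; case: (ltnP i j) => ij; apply/andP; split; lia.
Qed.

Definition lift_end (k : int) (i j : 'I_n) : int := if (i < j)%N then k else k + 1.

Lemma iota_periph k i j : iota_arc k (DPeriph i j) = SPeriph k i (lift_end k i j) j.
Proof. by rewrite /= /lift_end; case: ifP. Qed.

Lemma pos_lift_end k i j : pos (lift_end k i j) j = pos k i + (clockwise_steps i j)%:Z.
Proof.
rewrite /lift_end /clockwise_steps /pos; have hi := ltn_ord i; have hj := ltn_ord j.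
by case: (ltnP i j) => ij; rewrite ?mulrDl; lia.
Qed.

(** The inequalities are strict, because arcs may share endpoints. A bridging arc enters only
    through its foot. *)
Definition strip_crossing (a b : strip_arc n) : bool :=
  match a, b with
  | SBridge _ _, SBridge _ _ => false
  | SBridge k i, SPeriph k1 i1 l1 j1 => pos k1 i1 < pos k i < pos l1 j1
  | SPeriph k1 i1 l1 j1, SBridge k i => pos k1 i1 < pos k i < pos l1 j1
  | SPeriph k i l j, SPeriph k1 i1 l1 j1 =>
      (pos k i < pos k1 i1 < pos l j) && (pos l j < pos l1 j1)
      || (pos k1 i1 < pos k i < pos l1 j1) && (pos l1 j1 < pos l j)
  end.

Definition disc_crossing (a b : disc_arc n) : Prop :=
  exists k l, strip_crossing (iota_arc k a) (iota_arc l b).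

Lemma strip_crossingC a b : strip_crossing a b = strip_crossing b a.
Proof. by case: a => [? ?|? ? ? ?]; case: b => [? ?|? ? ? ?] //=; rewrite orbC. Qed.

Lemma strip_crossing_refl a : strip_crossing a a = false.
Proof. by case: a => [? ?|? ? ? ?] //=; rewrite !ltxx. Qed.

End Combinatorics.

Section StripArcs.
Local Open Scope ring_scope.
Variables (R : realType) (n : nat).

Lemma do_not_meetC (A : Type) (rep : A -> set (R -> R * R)) S a b :
  do_not_meet rep S a b <-> do_not_meet rep S b a.
Proof.
by split=> -[g [h [ga hb e]]]; exists h, g; split=> //; rewrite (setIC (h @` _)).
Qed.

Definition strip_x (k : int) (i : 'I_n) : R := k%:~R + (i.+1)%:R / (n.+1)%:R.

Lemma strip_x_lt_pos k i l j : pos k i < pos l j -> strip_x k i < strip_x l j.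
Proof.
have hn : 0 < (n.+1)%:R :> R by rewrite ltr0n.
rewrite -lower_lt_pos /lower_lt /strip_x => /orP[kl|/andP[/eqP-> ij]].
  apply: (@lt_le_trans _ _ (k%:~R + 1)).
    by rewrite ltrD2l ltr_pdivrMr // mul1r ltr_nat ltnS.
  apply: (@le_trans _ _ l%:~R).
    by rewrite -[1]/(1%:~R) -intrD ler_int; lia.
  by rewrite lerDl divr_ge0.
by rewrite ltrD2l ltr_pM2r ?invr_gt0 // ltr_nat ltnS.
Qed.

Lemma strip_x_lt k i l j : (strip_x k i < strip_x l j) = (pos k i < pos l j).
Proof.
case: (ltrgtP (pos k i) (pos l j)) => [h|h|/pos_inj[-> ->]]; last exact: ltxx.
  exact: strip_x_lt_pos.
by apply/negbTE; rewrite -leNgt; apply/ltW/strip_x_lt_pos.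
Qed.

Lemma strip_x_bounds k (i : 'I_n) : k%:~R < strip_x k i < k%:~R + 1.
Proof.
have hn : 0 < (n.+1)%:R :> R by rewrite ltr0n.
by rewrite ltrDl divr_gt0 //= ltrD2l ltr_pdivrMr // mul1r ltr_nat ltnS.
Qed.

Lemma strip_x_inj k i l j : strip_x k i = strip_x l j -> k = l /\ i = j.
Proof.
move=> e; apply: pos_inj; apply/eqP; rewrite eq_le !leNgt -!strip_x_lt e.
by rewrite ltxx.
Qed.

(** The graph of [c * (x - a) * (b - x)] between [a] and [b], run through at constant horizontal
    speed. *)
Definition parabola (c a b t : R) : R * R :=
  (a + t * (b - a), c * (b - a) ^+ 2 * (t * (1 - t))).

Lemma continuous_parabola c a b : continuous (parabola c a b).
Proof.
apply: continuous_pair => t.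
  by apply: cvgD; [exact: cvg_cst|apply: cvgM; [exact: cvg_id|exact: cvg_cst]].
apply: cvgM; first exact: cvg_cst.
by apply: cvgM; [exact: cvg_id|apply: cvgB; [exact: cvg_cst|exact: cvg_id]].
Qed.

Lemma parabola_y c a b t :
  (parabola c a b t).2 = c * (((parabola c a b t).1 - a) * (b - (parabola c a b t).1)).
Proof. by rewrite /parabola /=; ring. Qed.

Lemma parabola_height c a b t : 0 < c -> a < b -> c * (b - a) ^+ 2 < 1 ->
  0 < t < 1 -> 0 < (parabola c a b t).2 < 1.
Proof.
move=> c0 ab cab t01 /=; have q0 : 0 < c * (b - a) ^+ 2.
  by rewrite mulr_gt0 // exprn_gt0 // subr_gt0.
set q := c * _ in q0 cab *; have p0 : 0 < t * (1 - t) by rewrite mulr_gt0; lra.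
by rewrite mulr_gt0 //=; nra.
Qed.

(* With a common leading coefficient, the difference of the two quadratic
   functions is affine, so that nested parabolas do not meet. *)
Lemma parabolas_meet (a b c d x : R) :
  a < x < b -> c < x < d -> (x - a) * (b - x) = (x - c) * (d - x) ->
  ~~ ((a < c < b) && (b < d) || (c < a < d) && (d < b)) -> a = c /\ b = d.
Proof.
move=> /andP[ax xb] /andP[cx xd] e /norP[h1 h2].
have [ac|ca|ac] := ltrgtP a c.
- have db : d <= b.
    by rewrite leNgt; apply: contra h1 => ->; rewrite ac (lt_trans cx xb).
  have : (x - c) * (d - x) < (x - a) * (b - x).
    apply: (@lt_le_trans _ _ ((x - a) * (d - x))).
      by rewrite ltr_pM2r ?subr_gt0 //; lra.
    by rewrite ler_pM2l ?subr_gt0 //; lra.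
  by rewrite e ltxx.
- have bd : b <= d.
    by rewrite leNgt; apply: contra h2 => ->; rewrite ca (lt_trans ax xd).
  have : (x - a) * (b - x) < (x - c) * (d - x).
    apply: (@lt_le_trans _ _ ((x - c) * (b - x))).
      by rewrite ltr_pM2r ?subr_gt0 //; lra.
    by rewrite ler_pM2l ?subr_gt0 //; lra.
  by rewrite e ltxx.
move: e; rewrite ac => /mulfI e; split=> //.
by apply: (addIr (- x)); apply: e; rewrite subr_eq0 gt_eqF.
Qed.

End StripArcs.

(** * Compatibility in the strip is non-crossing *)

Section StripCompatibility.
Local Open Scope ring_scope.
Variables (R : realType) (n : nat).
Implicit Types (a b : strip_arc n).

Notation stripx := (@strip_x R n).

Lemma curves_meet (S : set (R * R)) (g h : R -> R * R) s t :
  (g @` `[0, 1]) `&` (h @` `[0, 1]) `&` S = set0 ->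
  0 <= s <= 1 -> 0 <= t <= 1 -> g s = h t -> S (g s) -> False.
Proof.
move=> e s01 t01 gh Sg; suff : set0 (g s) by [].
rewrite -e; split=> //; split; first by exists s => //=; rewrite in_itv.
by exists t; rewrite //= in_itv.
Qed.

Lemma curves_do_not_meet (S : set (R * R)) (g h : R -> R * R) :
  (forall s t, 0 <= s <= 1 -> 0 <= t <= 1 -> g s = h t -> S (g s) -> False) ->
  (g @` `[0, 1]) `&` (h @` `[0, 1]) `&` S = set0.
Proof.
move=> H; rewrite -subset0 => p [[[s + <-] [t + e]] Sg].
rewrite /= !in_itv => s01 t01; exact: (H s t s01 t01 (esym e)).
Qed.

Lemma parabola_0 c (x y : R) : parabola c x y 0 = (x, 0).
Proof. by rewrite /parabola !mul0r mulr0 addr0. Qed.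

Lemma parabola_1 c (x y : R) : parabola c x y 1 = (y, 0).
Proof. by rewrite /parabola subrr !mulr0 mul1r addrC subrK. Qed.

Lemma parabola_interior c (x y t : R) : x < y -> 0 <= t <= 1 ->
  0 < (parabola c x y t).2 -> 0 < t < 1.
Proof.
move=> xy /andP[t0 t1] h; rewrite !lt_neqAle t0 t1 !andbT.
apply/andP; split; apply: contraTneq h => e.
  by rewrite -e parabola_0 /= ltxx.
by rewrite e parabola_1 /= ltxx.
Qed.

Lemma parabola_x_itv c (x y t : R) : x < y -> 0 < t < 1 ->
  x < (parabola c x y t).1 < y.
Proof. by move=> xy t01 /=; apply/andP; split; nra. Qed.

Lemma strip_parabola c k (i : 'I_n) l j : pos k i < pos l j -> 0 < c ->
  c * (stripx l j - stripx k i) ^+ 2 < 1 ->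
  strip_representative (SPeriph k i l j) (parabola c (stripx k i) (stripx l j)).
Proof.
rewrite -(strip_x_lt R) => xy c0 c1; split; first by move=> t; exact: parabola_height.
split; rewrite ?parabola_0 ?parabola_1 //; split.
  exact/continuous_subspaceT/continuous_parabola.
move=> s t s0 st t1 [/addrI e _]; exfalso.
by move: e => /mulIf; rewrite subr_eq0 gt_eqF // => /(_ isT) e; rewrite e ltxx in st.
Qed.

Definition segment (p q : R * R) (t : R) : R * R :=
  (p.1 + t * (q.1 - p.1), p.2 + t * (q.2 - p.2)).

Lemma continuous_segment p q : continuous (segment p q).
Proof.
by apply: continuous_pair => t;
  (apply: cvgD; [exact: cvg_cst|apply: cvgM; [exact: cvg_id|exact: cvg_cst]]).
Qed.

Definition strip_segment k (i : 'I_n) : R -> R * R :=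
  segment (k%:~R + 1 / 2, 1) (stripx k i, 0).

Lemma strip_segmentP k (i : 'I_n) :
  strip_representative (SBridge k i) (strip_segment k i).
Proof.
split; first by move=> t t01; rewrite /strip_interior /=; lra.
split.
- split; first exact/continuous_subspaceT/continuous_segment.
  by move=> s t s0 st t1 [_]; lra.
- by rewrite /strip_segment /segment /= !mul0r !addr0.
- by rewrite /strip_segment /segment /= !mul1r ![_ + (_ - _)]addrC !subrK.
Qed.

Lemma convex_lt (u v u' v' s : R) : u < u' -> v < v' -> 0 <= s <= 1 ->
  u + s * (v - u) < u' + s * (v' - u').
Proof.
move=> uu vv /andP[]; rewrite le_eqVlt => /orP[/eqP<- _|s0 s1].
  by rewrite !mul0r !addr0.
rewrite -subr_gt0 (_ : _ - _ = (1 - s) * (u' - u) + s * (v' - v)); last by ring.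
by rewrite ltr_wpDl ?mulr_ge0 ?mulr_gt0 ?subr_gt0 ?subr_ge0 // ltW.
Qed.

(** Equal heights force equal parameters. Segments with distinct upper vertices keep their
    left-to-right order at every height; segments with the same upper vertex meet only there. *)
Lemma strip_bridges_do_not_meet k (i : 'I_n) l j : SBridge k i <> SBridge l j ->
  do_not_meet (@strip_representative R n) (@strip_interior R) (SBridge k i) (SBridge l j).
Proof.
have lt_case k' (i' : 'I_n) l' j' : k' < l' -> do_not_meet (@strip_representative R n)
    (@strip_interior R) (SBridge k' i') (SBridge l' j').
  move=> kl; exists (strip_segment k' i'), (strip_segment l' j').
  split; try exact: strip_segmentP.
  apply: curves_do_not_meet => s t s01 t01 [e1 e2] _.
  have st : s = t by lra.
  have : stripx k' i' < stripx l' j' by rewrite strip_x_lt -lower_lt_pos /lower_lt kl.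
  have : k'%:~R < l'%:~R :> R by rewrite ltr_int.
  move=> kl' xx; have uu : k'%:~R + 1 / 2 < l'%:~R + 1 / 2 :> R by rewrite ltrD2r.
  by move: e1 (convex_lt uu xx t01) => /=; rewrite st => ->; rewrite ltxx.
case: (ltrgtP k l) => [kl _|lk _|-> ij]; first exact: lt_case.
  by apply/do_not_meetC/lt_case.
exists (strip_segment l i), (strip_segment l j); split; try exact: strip_segmentP.
apply: curves_do_not_meet => s t s01 t01 [e1 e2].
rewrite /strip_interior /= => s01'.
have st : s = t by lra.
move: e1; rewrite st => /addrI/mulfI e1; apply: ij; congr SBridge.
have /addIr/strip_x_inj[] // : stripx l i - (l%:~R + 1 / 2) = stripx l j - (l%:~R + 1 / 2).
by apply: e1; rewrite gt_eqF //; lra.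
Qed.

(** The coefficient [(1 + x + y)^-1] brings two given quantities below 1 at once; the bound for [y]
    comes from exchanging the summands. *)
Lemma inv1D_bound (x y : R) : 0 <= x -> 0 <= y -> (1 + x + y)^-1 * x < 1.
Proof. by move=> x0 y0; rewrite mulrC ltr_pdivrMr; lra. Qed.

Lemma inv1D_gt0 (x y : R) : 0 <= x -> 0 <= y -> 0 < (1 + x + y)^-1.
Proof. by move=> x0 y0; rewrite invr_gt0; lra. Qed.

(** The choice of [c] keeps the slope of the parabola below 1 in absolute value, whereas the segment
    deviates horizontally from its foot by at most half its height. With the foot outside the open
    base interval, the two cannot meet above the boundary. *)
Lemma strip_bridge_periph_do_not_meet k (i : 'I_n) k1 i1 l1 j1 :
  pos k1 i1 < pos l1 j1 -> ~~ (pos k1 i1 < pos k i < pos l1 j1) ->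
  do_not_meet (@strip_representative R n) (@strip_interior R)
    (SBridge k i) (SPeriph k1 i1 l1 j1).
Proof.
move=> p1; rewrite -!(strip_x_lt R) => nx.
have xy := p1; rewrite -(strip_x_lt R) in xy.
set x := stripx k1 i1 in nx xy; set y := stripx l1 j1 in nx xy; set z := stripx k i in nx.
pose L := y - x; have L0 : 0 <= L by rewrite /L subr_ge0 ltW.
pose c := (1 + L + L ^+ 2)^-1.
have c0 : 0 < c by apply: inv1D_gt0; rewrite ?sqr_ge0.
have cL : c * L < 1 by apply: inv1D_bound; rewrite ?sqr_ge0.
have cL2 : c * L ^+ 2 < 1 by rewrite /c addrAC; apply: inv1D_bound; rewrite ?sqr_ge0.
exists (strip_segment k i), (parabola c x y).
split; [exact: strip_segmentP|exact: strip_parabola|].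
apply: curves_do_not_meet => s t s01 t01 e; rewrite e => /andP[h0 h1].
have t01' := parabola_interior xy t01 h0.
have := parabola_x_itv c xy t01'; have := parabola_y c x y t; move: h0 h1.
rewrite -e /strip_segment /segment /= -/z.
have := strip_x_bounds R k i; rewrite -/z.
set y0 := 1 + s * (0 - 1).
(* The abscissa on the segment is expressed by the height [y0]; the offset [v] of the upper vertex
   from the foot is less than 1/2 in absolute value. *)
have -> : k%:~R + 1 / 2 + s * (z - (k%:~R + 1 / 2)) =
    z + y0 * (k%:~R + 1 / 2 - z).
  by rewrite /y0; ring.
set v := k%:~R + 1 / 2 - z => hz.
have hv : - (1 / 2) < v < 1 / 2 by rewrite /v; lra.
clearbody y0 v; move ew : (z + y0 * v) => w y00 y01 ey /andP[hx hy].
case/nandP: nx; rewrite -leNgt => zx.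
  have yb : y0 <= c * L * (w - x).
    by rewrite ey -mulrA ler_pM2l // [L * _]mulrC ler_pM2l ?subr_gt0 // /L; lra.
  have : c * L * (w - x) < w - x by rewrite gtr_pMl // subr_gt0.
  by nra.
have yb : y0 <= c * L * (y - w).
  by rewrite ey -mulrA ler_pM2l // ler_pM2r ?subr_gt0 // /L; lra.
have : c * L * (y - w) < y - w by rewrite gtr_pMl // subr_gt0.
by nra.
Qed.

Lemma strip_periphs_do_not_meet k (i : 'I_n) l j k1 i1 l1 j1 :
  pos k i < pos l j -> pos k1 i1 < pos l1 j1 ->
  SPeriph k i l j <> SPeriph k1 i1 l1 j1 ->
  ~~ strip_crossing (SPeriph k i l j) (SPeriph k1 i1 l1 j1) ->
  do_not_meet (@strip_representative R n) (@strip_interior R)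
    (SPeriph k i l j) (SPeriph k1 i1 l1 j1).
Proof.
move=> p p1 ne; rewrite /= -!(strip_x_lt R) => ncr.
have xy := p; have xy1 := p1; rewrite -(strip_x_lt R) in xy; rewrite -(strip_x_lt R) in xy1.
pose L := (stripx l j - stripx k i) ^+ 2; pose L1 := (stripx l1 j1 - stripx k1 i1) ^+ 2.
have L0 : 0 <= L by exact: sqr_ge0.
have L10 : 0 <= L1 by exact: sqr_ge0.
pose c := (1 + L + L1)^-1; have c0 : 0 < c by exact: inv1D_gt0.
exists (parabola c (stripx k i) (stripx l j)), (parabola c (stripx k1 i1) (stripx l1 j1)).
split.
- by apply: strip_parabola => //; exact: inv1D_bound.
- by apply: strip_parabola => //; rewrite -/L1 /c addrAC; exact: inv1D_bound.
apply: curves_do_not_meet => s t s01 t01 e; rewrite /strip_interior /= => /andP[h _].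
have s01' := parabola_interior xy s01 h.
have h1 : 0 < (parabola c (stripx k1 i1) (stripx l1 j1) t).2 by rewrite -e.
have t01' := parabola_interior xy1 t01 h1.
have := parabola_y c (stripx k i) (stripx l j) s.
rewrite [X in X.2]e parabola_y => /mulfI; rewrite gt_eqF // => /(_ isT) ey.
have hx := parabola_x_itv c xy s01'; have hx1 := parabola_x_itv c xy1 t01'.
rewrite -e in hx1 ey.
have [/strip_x_inj[] ? ? /strip_x_inj[] ? ?] := parabolas_meet hx hx1 (esym ey) ncr.
by apply: ne; subst.
Qed.

Lemma strip_rep_y a g : strip_representative a g ->
  forall t : R, 0 <= t <= 1 -> 0 <= (g t).2 <= 1.
Proof.
move=> [gi [_ g0 g1]] t /andP[]; rewrite le_eqVlt => /orP[/eqP<- _|t0].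
  by rewrite g0; case: (left_end a) => [?|? ?] /=; rewrite ?lexx ?ler01.
rewrite le_eqVlt => /orP[/eqP->|t1]; last first.
  by have := gi t; rewrite t0 t1 => /(_ isT) /andP[? ?]; rewrite !ltW.
by rewrite g1; case: (right_end a) => [?|? ?] /=; rewrite ?lexx ?ler01.
Qed.

Lemma strip_rep_end a g : strip_representative a g ->
  forall t : R, 0 <= t <= 1 -> strip_interior (g t) \/
    g t = strip_point R (left_end a) \/ g t = strip_point R (right_end a).
Proof.
move=> [gi [_ g0 g1]] t /andP[]; rewrite le_eqVlt => /orP[/eqP<- _|t0].
  by right; left.
rewrite le_eqVlt => /orP[/eqP->|t1]; first by right; right.
by left; apply: gi; rewrite t0 t1.
Qed.

(** The crossing lemmas yield a common point in the closed strip. It is interior: otherwise it would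
    be an endpoint of both curves, but crossing arcs have no common endpoint. *)
Lemma strip_do_not_meet_noncrossing a b :
  do_not_meet (@strip_representative R n) (@strip_interior R) a b ->
  ~~ strip_crossing a b.
Proof.
have bridge_case k (i : 'I_n) k1 i1 l1 j1 :
    do_not_meet (@strip_representative R n) (@strip_interior R)
      (SBridge k i) (SPeriph k1 i1 l1 j1) ->
    ~~ strip_crossing (SBridge k i) (SPeriph k1 i1 l1 j1).
  move=> [h [g [hr gr e]]]; apply/negP => /=; rewrite -!(strip_x_lt R) => cr.
  have [gi [[gc _] g0 g1]] := gr; have [hi [[hc _] h0 h1]] := hr.
  have gy := strip_rep_y gr; have hy := strip_rep_y hr.
  have [|t t01|s [t [s01 t01 st]]] := crossing_bridge gc hc g0 g1 h1 cr.
  - by move=> t t01; rewrite h0 gy.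
  - by case/andP: (hy _ t01).
  apply: (curves_meet e t01 s01 (esym st)); rewrite -st.
  have := strip_rep_end hr t01; rewrite -st.
  case: (strip_rep_end gr s01) => [//|[]->] [//|[]] /= [] exi;
    try by move/eqP; rewrite eq_sym oner_eq0.
    by move: cr; rewrite /strip_x exi ltxx.
  by move: cr; rewrite /strip_x exi ltxx andbF.
have periph_case k (i : 'I_n) l j k1 i1 l1 j1 :
    do_not_meet (@strip_representative R n) (@strip_interior R)
      (SPeriph k i l j) (SPeriph k1 i1 l1 j1) ->
    ~~ ((pos k i < pos k1 i1 < pos l j) && (pos l j < pos l1 j1)).
  move=> [g [h [gr hr e]]]; apply/negP; rewrite -!(strip_x_lt R) => /andP[cr bd].
  have [gi [[gc _] g0 g1]] := gr; have [hi [[hc _] h0 h1]] := hr.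
  have gy := strip_rep_y gr; have hy := strip_rep_y hr.
  have [t t01|t t01|s [t [s01 t01 st]]] := crossing_arcs gc hc g0 g1 h0 h1 cr bd.
  - by case/andP: (gy _ t01).
  - by case/andP: (hy _ t01).
  apply: (curves_meet e s01 t01 st).
  have := strip_rep_end hr t01; rewrite -st.
  have [ac cb] := andP cr; have ad := lt_trans ac (lt_trans cb bd).
  case: (strip_rep_end gr s01) => [//|[]->] [//|[]] /= [exi].
  - by move: ac; rewrite /strip_x exi ltxx.
  - by move: ad; rewrite /strip_x exi ltxx.
  - by move: cb; rewrite /strip_x exi ltxx.
  - by move: bd; rewrite /strip_x exi ltxx.
case: a b => [k i|k i l j] [k1 i1|k1 i1 l1 j1] //.
- exact: bridge_case.
- by move/do_not_meetC; rewrite strip_crossingC; exact: bridge_case.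
move=> h; rewrite negb_or periph_case //.
by apply: periph_case; exact/do_not_meetC.
Qed.

Theorem strip_do_not_meetP a b : strip_arcs a -> strip_arcs b -> a <> b ->
  do_not_meet (@strip_representative R n) (@strip_interior R) a b <->
  ~~ strip_crossing a b.
Proof.
move=> Ha Hb ne; split; first exact: strip_do_not_meet_noncrossing.
case: a b Ha Hb ne => [k i|k i l j] [k1 i1|k1 i1 l1 j1] Ha Hb ne.
- by move=> _; exact: strip_bridges_do_not_meet.
- by apply: strip_bridge_periph_do_not_meet; rewrite -lower_lt_pos; case: Hb.
- rewrite strip_crossingC => h; apply/do_not_meetC.
  by apply: strip_bridge_periph_do_not_meet => //; rewrite -lower_lt_pos; case: Ha.
- by apply: strip_periphs_do_not_meet => //; rewrite -lower_lt_pos;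
    [case: Ha|case: Hb].
Qed.

End StripCompatibility.

(** * Arcs of the punctured disc *)

Section DiscCurves.
Local Open Scope ring_scope.
Variables (R : realType) (n : nat).
Hypothesis n_gt0 : (0 < n)%N.
Implicit Types (z w : R * R) (x y t u : R).

Notation nR := (n%:R : R).

Let nR_gt0 : 0 < nR. Proof. by rewrite ltr0n. Qed.
Let pi0 : 0 < pi :> R. Proof. exact: pi_gt0. Qed.

(** A product of types instead of a conjunction, so that rewriting can use either equation. *)
Lemma cos_sin_period (m : int) t :
  (cos (t + m%:~R * (pi *+ 2)) = cos t) * (sin (t + m%:~R * (pi *+ 2)) = sin t).
Proof.
have H (k : nat) u :
    (cos (u + k%:R * (pi *+ 2)) = cos u) * (sin (u + k%:R * (pi *+ 2)) = sin u).
  by rewrite mulr_natl (periodicn (@cosD2pi R)) (periodicn (@sinD2pi R)).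
case: m => k; first exact: H.
rewrite NegzE mulrNz mulNr.
by have [<- <-] := H k.+1 (t - k.+1%:R * (pi *+ 2)); rewrite subrK.
Qed.

(** After reduction modulo [2 pi], half of the remainder is some [u] in [[0, pi)] with
    [cos (2 u) = 1]; hence [sin u = 0] and [u = 0]. *)
Lemma cos_eq1 t : cos t = 1 -> exists m : int, t = m%:~R * (pi *+ 2).
Proof.
move=> ct; pose m := Num.floor (t / (pi *+ 2)); exists m.
have tp : 0 < pi *+ 2 :> R by rewrite pmulrn_lgt0.
pose u := (t + (- m)%:~R * (pi *+ 2)) / 2.
have tE : t + (- m)%:~R * (pi *+ 2) = u *+ 2 by rewrite /u -mulr_natr mulfVK.
have : cos (u *+ 2) = 1 by rewrite -tE cos_sin_period.
rewrite cos_mulr2n cos2sin2 => /eqP cu.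
have su : sin u = 0.
  by apply/eqP; rewrite -sqrf_eq0; apply/eqP; move: cu => /eqP; lra.
have : m%:~R <= t / (pi *+ 2) < (m + 1)%:~R by rewrite real_floor_itv ?num_real.
rewrite ler_pdivlMr // ltr_pdivrMr // intrD mulrDl mul1r => /andP[h1 h2].
have u0 : 0 <= u by rewrite divr_ge0 // mulrNz mulNr subr_ge0.
have up : u < pi by move: tE; rewrite mulrNz mulNr; lra.
move: u0; rewrite le_eqVlt => /orP[/eqP u0|u0].
  by move: tE; rewrite -u0 mul0rn mulrNz mulNr => /eqP; rewrite subr_eq0 => /eqP.
by have := @sin_gt0_pi R u; rewrite u0 up su ltxx => /(_ isT).
Qed.

(** The sign makes the rays turn clockwise as [x] grows, with one full turn per [n] units. *)
Definition ray_angle x : R := - (2 * pi * x / nR).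
Definition on_ray x z : Prop := polar (ray_angle x) z.

Lemma circle_ptE x : circle_pt n x = (cos (ray_angle x), sin (ray_angle x)).
Proof. by rewrite /circle_pt /ray_angle cosN sinN. Qed.

Lemma ray_angleD x m : ray_angle (x + m%:~R * nR) = ray_angle x + (- m)%:~R * (pi *+ 2).
Proof. by rewrite /ray_angle mulrNz; move: (pi : R) => p; field; rewrite gt_eqF. Qed.

Lemma circle_pt_period (m : int) x : circle_pt n (x + m%:~R * nR) = circle_pt n x.
Proof. by rewrite !circle_ptE ray_angleD !cos_sin_period. Qed.

Lemma on_ray_circle_pt x : on_ray x (circle_pt n x).
Proof. by exists 1 => //; rewrite !mul1r circle_ptE. Qed.

Lemma on_ray_period (m : int) x z : on_ray x z -> on_ray (x + m%:~R * nR) z.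
Proof.
move=> [r r0 ->]; exists r => //; rewrite ray_angleD.
by rewrite !cos_sin_period.
Qed.

Lemma on_ray_eq x y z : on_ray x z -> on_ray y z ->
  exists m : int, x = y + m%:~R * nR.
Proof.
move=> xz yz; have [/cos_eq1[m e] _] := polar_uniq xz yz.
exists (- m); move: e; rewrite /ray_angle mulrNz => e.
have {}e : (y - x) * (pi *+ 2) / nR = m%:~R * (pi *+ 2).
  by rewrite -e; move: (pi : R) => p; field; rewrite gt_eqF.
have {}e : (y - x) = m%:~R * nR.
  apply: (@mulIf _ ((pi *+ 2) / nR)).
    by rewrite gt_eqF // divr_gt0 // pmulrn_lgt0.
  by rewrite mulrA e; move: (pi : R) => p; field; rewrite gt_eqF.
by rewrite mulNr -e; ring.
Qed.

Lemma on_ray_inj x z w : on_ray x z -> on_ray x w -> sqnorm z = sqnorm w -> z = w.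
Proof.
move=> [r r0 ->] [q q0 ->]; rewrite /sqnorm /= !exprMn -!mulrDr cos2Dsin2 !mulr1.
by move=> /eqP; rewrite eqrXn2 ?ltW // => /eqP ->.
Qed.

Lemma sqnorm_circle_pt x : sqnorm (circle_pt n x) = 1.
Proof. by rewrite circle_ptE /sqnorm /= cos2Dsin2. Qed.

Lemma sqnorm_gt0 z : 0 < sqnorm z -> z != (0, 0).
Proof. by apply: contraTneq => ->; rewrite /sqnorm /= expr0n addr0 ltxx. Qed.

Lemma polar_shift t d z : polar t z -> cos d = 1 -> sin d = 0 -> polar (t + d) z.
Proof.
move=> [r r0 ->] cd sd; exists r => //.
by rewrite cosD sinD cd sd !mulr1 !mulr0 subr0 addr0.
Qed.

Lemma ray_angleK t : ray_angle (- (t * nR / (pi *+ 2))) = t.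
Proof. by rewrite /ray_angle; move: (pi : R) pi0 => p p0; field; rewrite !gt_eqF. Qed.

(** [angle_lifting] is applied to a map of the square that ignores its second argument. The lift is
    normalized at parameter 1, where a bridging arc has its boundary vertex. *)
Lemma path_lifting (K : R -> R * R) x :
  {within `[0, 1], continuous K} -> (forall t, 0 <= t <= 1 -> K t != (0, 0)) ->
  on_ray x (K 1) ->
  exists f : R -> R, [/\ continuous f, f 1 = x &
    forall t, 0 <= t <= 1 -> on_ray (f t) (K t)].
Proof.
move=> cK K0 xK.
have cKc : continuous ((K \o @clamp R) \o (fst : R * R -> R)).
  move=> p; apply: continuous_comp; first exact: cvg_fst.
  exact: continuous_within_unit.
have [|th cth thK] := angle_lifting (continuous_subspaceT cKc).
  by move=> p _ /=; apply: K0; exact: clamp_itv.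
have polK t : 0 <= t <= 1 -> polar (th (t, 0)) (K t).
  move=> t01; have := thK (t, 0); rewrite /= clamp_id //; apply.
  by rewrite unit_squareE lexx ler01.
have i1 : 0 <= (1 : R) <= 1 by rewrite lexx ler01.
have [c1 s1] := polar_uniq xK (polK _ i1).
exists (fun t => - ((th (t, 0) + (ray_angle x - th (1, 0))) * nR / (pi *+ 2))); split.
- move=> t; apply: cvgN; apply: cvgM; last exact: cvg_cst.
  apply: cvgM; last exact: cvg_cst; apply: cvgD; last exact: cvg_cst.
  apply: (@continuous_comp _ _ _ (fun s => (s, 0)) th); last exact: cth.
  by apply: (@continuous_pair _ _ _ id (cst 0)) => ?; [exact: cvg_id|exact: cvg_cst].
- by rewrite addrC subrK /ray_angle; move: (pi : R) pi0 => p p0; field; rewrite !gt_eqF.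
- by move=> t t01; rewrite /on_ray ray_angleK; apply: polar_shift => //; exact: polK.
Qed.

(** [trapped] confines [f t] to the half-turns on both sides of [f 0], which share only [f 0]. *)
Lemma constant_angle (f : R -> R) : continuous f ->
  (forall t, 0 <= t <= 1 -> sin (f t - f 0) = 0) ->
  forall t, 0 <= t <= 1 -> f t = f 0.
Proof.
move=> cf fs t t01; have i0 : 0 <= (0 : R) <= 1 by rewrite lexx ler01.
have h1 : f 0 <= f t <= f 0 + pi.
  apply: (trapped cf _ i0) => // [s s01|]; first by rewrite fs.
  by rewrite lexx /= lerDl ltW.
have h2 : f 0 - pi <= f t <= f 0 - pi + pi.
  apply: (trapped cf _ i0) => // [s s01|]; last by lra.
  by rewrite opprB addrA addrAC sinDpi fs // oppr0.
by lra.
Qed.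

(** An angle is lifted over the whole isotopy square. It is constant along the two sides where the
    endpoints stay fixed, so [g] turns by the same total angle as the boundary path, whose angle
    [al] is explicit. *)
Lemma periph_lifting (i j : 'I_n) g : disc_representative (DPeriph i j) g ->
  exists f : R -> R, [/\ continuous f, f 0 = (i.+1)%:R,
    f 1 = (i.+1)%:R + (clockwise_steps i j)%:R &
    forall t, 0 <= t <= 1 -> on_ray (f t) (g t)].
Proof.
move=> [gi [[_ g0 g1] [H [cH H0 H1 Hs HS]]]].
set s := (clockwise_steps i j)%:R.
have [p|th cth thH] := angle_lifting cH.
  case: p => u t; rewrite unit_squareE => -[u01 t01].
  by have /andP[h _] := HS u t u01 t01; exact: sqnorm_gt0.
have i0 : 0 <= (0 : R) <= 1 by rewrite lexx ler01.
have i1 : 0 <= (1 : R) <= 1 by rewrite lexx ler01.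
have thp u t : 0 <= u <= 1 -> 0 <= t <= 1 -> polar (th (u, t)) (H (u, t)).
  by move=> ? ?; apply: thH; rewrite unit_squareE.
have ch t : continuous (fun s => th (s, t)).
  move=> u; apply: (@continuous_comp _ _ _ (fun s => (s, t)) th); last exact: cth.
  by apply: (@continuous_pair _ _ _ id (cst t)) => ?; [exact: cvg_id|exact: cvg_cst].
have cv u : continuous (fun t => th (u, t)).
  move=> t; apply: (@continuous_comp _ _ _ (fun t => (u, t)) th); last exact: cth.
  by apply: (@continuous_pair _ _ _ (cst u) id) => ?; [exact: cvg_cst|exact: cvg_id].
have left_end : th (1, 0) = th (0, 0).
  apply: (constant_angle (ch 0)) => // u u01.
  apply: (polar_uniq (z := g 0) _ _).2; last by rewrite -H0 //; exact: thp.
  by have [_ <- _] := Hs u u01; exact: thp.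
have right_end : th (1, 1) = th (0, 1).
  apply: (constant_angle (ch 1)) => // u u01.
  apply: (polar_uniq (z := g 1) _ _).2; last by rewrite -H0 //; exact: thp.
  by have [_ _ <-] := Hs u u01; exact: thp.
pose al t := ray_angle ((i.+1)%:R + t * s).
have alP t : 0 <= t <= 1 -> polar (al t) (H (1, t)).
  by move=> t01; rewrite H1 //; exact: on_ray_circle_pt.
have cal : continuous al.
  move=> t; apply: cvgN; apply: cvgM; last exact: cvg_cst.
  apply: cvgM; first exact: cvg_cst; apply: cvgD; first exact: cvg_cst.
  by apply: cvgM; [exact: cvg_id|exact: cvg_cst].
have diff : th (1, 1) - al 1 = th (1, 0) - al 0.
  apply: (@constant_angle (fun t => th (1, t) - al t)) => //.
    by move=> t; apply: cvgB; [exact: cv|exact: cal].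
  move=> t t01; rewrite sinB.
  have [c1 s1] := polar_uniq (thp _ _ i1 t01) (alP _ t01).
  have [c0 s0] := polar_uniq (thp _ _ i1 i0) (alP _ i0).
  by rewrite s1 s0 mul0r mulr0 subrr.
have [c0 s0] := polar_uniq (alP _ i0) (thp _ _ i1 i0).
(* The added constant is a multiple of [2 pi]: it leaves the rays unchanged and makes the lift start
   exactly at [i.+1]. *)
exists (fun t => - ((th (0, t) + (al 0 - th (1, 0))) * nR / (pi *+ 2))); split.
- move=> t; apply: cvgN; apply: cvgM; last exact: cvg_cst.
  by apply: cvgM; last exact: cvg_cst; apply: cvgD; [exact: cv|exact: cvg_cst].
- rewrite left_end addrC subrK /al /ray_angle; move: (pi : R) pi0 => p p0.
  by field; rewrite !gt_eqF.
- rewrite -right_end (_ : _ + _ = al 1); last by move: diff; lra.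
  by rewrite /al /ray_angle; move: (pi : R) pi0 => p p0; field; rewrite !gt_eqF.
- move=> t t01; rewrite /on_ray ray_angleK; apply: polar_shift => //.
  by rewrite -H0 //; exact: thp.
Qed.

End DiscCurves.

(** * Non-crossing disc arcs have disjoint representatives *)

Section DiscCompatibility.
Local Open Scope ring_scope.
Variables (R : realType) (n : nat).
Hypothesis n_gt0 : (0 < n)%N.
Implicit Types (p q z w : R * R) (x y t u : R) (i j : 'I_n) (k l m : int).

Notation nR := (n%:R : R).
Notation dnm := (do_not_meet (@disc_representative R n) (@punctured_disc_interior R)).

Let nR_gt0 : 0 < nR. Proof. by rewrite ltr0n. Qed.

(* The shift by 1 comes from disc_vertex i = circle_pt i.+1. *)
Definition disc_x k i : R := (pos k i)%:~R + 1.

Lemma disc_xE k i : disc_x k i = (i.+1)%:R + k%:~R * nR.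
Proof. by rewrite /disc_x /pos intrD intrM -natr1 -addrA addrC. Qed.

Lemma disc_x_lift_end k i j :
  disc_x (lift_end k i j) j = disc_x k i + (clockwise_steps i j)%:R.
Proof. by rewrite /disc_x pos_lift_end intrD addrAC. Qed.

Lemma disc_x_lt k i l j : (disc_x k i < disc_x l j) = (pos k i < pos l j).
Proof. by rewrite ltrD2r ltr_int. Qed.

Lemma disc_vertexE k i : disc_vertex R i = circle_pt n (disc_x k i).
Proof. by rewrite disc_xE circle_pt_period. Qed.

Lemma disc_x_inj k i l j : disc_x k i = disc_x l j -> k = l /\ i = j.
Proof. by move=> /addIr /intr_inj; exact: pos_inj. Qed.

(** The covering map from strip coordinates: the abscissa becomes the clockwise position, height 0
    goes to the boundary circle and height 1 to the puncture. *)
Definition disc_pt p : R * R :=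
  ((1 - p.2) * (circle_pt n p.1).1, (1 - p.2) * (circle_pt n p.1).2).

Lemma sqnorm_disc_pt p : sqnorm (disc_pt p) = (1 - p.2) ^+ 2.
Proof.
have := sqnorm_circle_pt n p.1.
by rewrite /sqnorm /= !exprMn -mulrDr => ->; rewrite mulr1.
Qed.

Lemma on_ray_disc_pt p : p.2 < 1 -> on_ray n p.1 (disc_pt p).
Proof.
move=> p1; exists (1 - p.2); first by rewrite subr_gt0.
by rewrite /disc_pt circle_ptE.
Qed.

Lemma disc_pt0 x : disc_pt (x, 0) = circle_pt n x.
Proof. by rewrite /disc_pt /= subr0 !mul1r. Qed.

Lemma disc_pt_eq p q : p.2 < 1 -> q.2 < 1 -> disc_pt p = disc_pt q ->
  p.2 = q.2 /\ exists m : int, p.1 = q.1 + m%:~R * nR.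
Proof.
move=> p1 q1 e; split.
  have /eqP := congr1 (@sqnorm R) e; rewrite !sqnorm_disc_pt eqrXn2 ?subr_ge0 ?ltW //.
  by move=> /eqP; lra.
apply: (on_ray_eq n_gt0 (on_ray_disc_pt p1)); rewrite e; exact: on_ray_disc_pt.
Qed.

Lemma continuous_circle_pt : continuous (circle_pt n : R -> R * R).
Proof.
have ca : continuous (ray_angle n : R -> R).
  move=> x; apply: cvgN; apply: cvgM; last exact: cvg_cst.
  by apply: cvgM; [exact: cvg_cst|exact: cvg_id].
rewrite (_ : circle_pt n = fun x => (cos (ray_angle n x), sin (ray_angle n x))); last first.
  by apply/funext => x; exact: circle_ptE.
apply: continuous_pair => x.
  by apply: (@continuous_comp _ _ _ (ray_angle n) cos); [exact: ca|exact: continuous_cos].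
by apply: (@continuous_comp _ _ _ (ray_angle n) sin); [exact: ca|exact: continuous_sin].
Qed.

Lemma continuous_disc_pt : continuous disc_pt.
Proof.
have c1 : continuous (fun p => circle_pt n p.1 : R * R).
  by move=> p; apply: continuous_comp; [exact: cvg_fst|exact: continuous_circle_pt].
have c2 : continuous (fun p : R * R => 1 - p.2).
  by move=> p; apply: cvgB; [exact: cvg_cst|exact: cvg_snd].
apply: continuous_pair => p; apply: cvgM; try exact: c2.
- exact: (continuous_proj1 c1).
- exact: (continuous_proj2 c1).
Qed.

Definition wrapped_parabola (c x y t : R) : R * R := disc_pt (parabola c x y t).

Lemma parabola_height_le (c x y t : R) : 0 <= c -> c * (y - x) ^+ 2 < 1 ->
  0 <= t <= 1 -> 0 <= (parabola c x y t).2 < 1.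
Proof.
move=> c0 c1 t01 /=; have q0 : 0 <= c * (y - x) ^+ 2 by rewrite mulr_ge0 ?sqr_ge0.
set q := c * _ in q0 c1 *; have p0 : 0 <= t * (1 - t) by rewrite mulr_ge0; lra.
by rewrite mulr_ge0 //=; nra.
Qed.

(** Distinct points with the same image are a nonzero multiple of [n] apart horizontally, which a
    base of length at most [n] allows only for its two ends. The case [c = 0] is included because
    the isotopy to the boundary path ends there. *)
Lemma wrapped_parabola_simple c x y : 0 <= c -> c * (y - x) ^+ 2 < 1 ->
  x < y -> y - x <= nR ->
  simple_curve_from_to (wrapped_parabola c x y) (circle_pt n x) (circle_pt n y).
Proof.
move=> c0 c1 xy yx; split; last 2 first.
- by rewrite /wrapped_parabola parabola_0 disc_pt0.
- by rewrite /wrapped_parabola parabola_1 disc_pt0.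
split.
  apply: continuous_subspaceT => t; apply: continuous_comp.
    exact: continuous_parabola.
  exact: continuous_disc_pt.
move=> s t s0 st t1 e.
have hs : (parabola c x y s).2 < 1.
  have s01 : 0 <= s <= 1 by lra.
  by case/andP: (parabola_height_le c0 c1 s01).
have ht : (parabola c x y t).2 < 1.
  have t01 : 0 <= t <= 1 by lra.
  by case/andP: (parabola_height_le c0 c1 t01).
have [_ [m]] := disc_pt_eq ht hs (esym e).
rewrite /= -addrA => /addrI em.
have {}em : (t - s) * (y - x) = m%:~R * nR by move: em; lra.
have m0 : (0 < m)%R.
  rewrite -(ltr_int R); have : 0 < m%:~R * nR by rewrite -em mulr_gt0 ?subr_gt0.
  by rewrite pmulr_lgt0.
have m1 : 1 <= m%:~R :> R by rewrite -[1]/(1%:~R) ler_int; lia.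
have : nR <= (t - s) * (y - x) by rewrite em ler_peMl // ltW.
have yx0 : 0 < y - x by rewrite subr_gt0.
by move=> h; nra.
Qed.

Lemma wrapped_parabola_interior c x y t : 0 < c -> c * (y - x) ^+ 2 < 1 ->
  x < y -> 0 < t < 1 -> punctured_disc_interior (wrapped_parabola c x y t).
Proof.
move=> c0 c1 xy t01; have /andP[] := parabola_height c0 xy c1 t01.
rewrite /punctured_disc_interior /mkset /wrapped_parabola sqnorm_disc_pt.
move: (parabola c x y t).2 => v v0 v1.
by rewrite exprn_gt0 ?subr_gt0 //= expr_lt1 ?subr_ge0 ?ltW //; lra.
Qed.

Lemma clockwise_steps_gt0 i j : 0 < (clockwise_steps i j)%:R :> R.
Proof. by rewrite ltr0n; case/andP: (clockwise_steps_bounds i j). Qed.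

Lemma clockwise_steps_le i j : (clockwise_steps i j)%:R <= nR.
Proof. by rewrite ler_nat; case/andP: (clockwise_steps_bounds i j). Qed.

Lemma parabola_lt1 c k i j : 0 < c -> c * nR ^+ 2 < 1 ->
  c * (disc_x (lift_end k i j) j - disc_x k i) ^+ 2 < 1.
Proof.
move=> c0; apply: le_lt_trans; rewrite disc_x_lift_end [_ + _ - _]addrC addKr.
by rewrite ler_pM2l // lerXn2r ?nnegrE ?clockwise_steps_le // ltW // clockwise_steps_gt0.
Qed.

(** Letting the coefficient shrink from [c] to 0 flattens the parabola onto its base; wrapped around
    the puncture, this is the isotopy to the boundary path. *)
Lemma wrapped_parabola_rep c k i j : 0 < c -> c * nR ^+ 2 < 1 ->
  disc_representative (DPeriph i j)
    (wrapped_parabola c (disc_x k i) (disc_x (lift_end k i j) j)).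
Proof.
move=> c0 cn; set x := disc_x k i; set y := disc_x (lift_end k i j) j.
have yx : y - x = (clockwise_steps i j)%:R by rewrite /y disc_x_lift_end /x addrC addKr.
have xy : x < y by rewrite -subr_gt0 yx clockwise_steps_gt0.
have yxn : y - x <= nR by rewrite yx clockwise_steps_le.
have yx2 : (y - x) ^+ 2 <= nR ^+ 2 by rewrite lerXn2r ?nnegrE // subr_ge0 ltW.
have cyx c' : c' <= c -> 0 <= c' -> c' * (y - x) ^+ 2 < 1.
  by move=> c'c c'0; apply: le_lt_trans cn; rewrite ler_pM ?sqr_ge0.
have simp c' : c' <= c -> 0 <= c' ->
    simple_curve_from_to (wrapped_parabola c' x y) (disc_vertex R i) (disc_vertex R j).
  move=> c'c c'0; rewrite (disc_vertexE k i) (disc_vertexE (lift_end k i j) j).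
  by apply: wrapped_parabola_simple => //; exact: cyx.
split; first by move=> t; apply: wrapped_parabola_interior => //; apply: cyx => //; exact: ltW.
split; first by apply: simp => //; exact: ltW.
exists (fun p => wrapped_parabola ((1 - p.1) * c) x y p.2).
have c'P u : 0 <= u <= 1 -> (1 - u) * c <= c /\ 0 <= (1 - u) * c.
  by move=> u01; rewrite ler_piMl ?mulr_ge0 //; lra.
split.
- have cpar : continuous (fun p : R * R => parabola ((1 - p.1) * c) x y p.2).
    apply: continuous_pair => p.
      by apply: cvgD; [exact: cvg_cst|apply: cvgM; [exact: cvg_snd|exact: cvg_cst]].
    apply: cvgM; last by apply: cvgM; [exact: cvg_snd|
      apply: cvgB; [exact: cvg_cst|exact: cvg_snd]].
    apply: cvgM; last exact: cvg_cst; apply: cvgM; last exact: cvg_cst.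
    by apply: cvgB; [exact: cvg_cst|exact: cvg_fst].
  apply: continuous_subspaceT => p; apply: continuous_comp; first exact: cpar.
  exact: continuous_disc_pt.
- by move=> t _ /=; rewrite subr0 mul1r.
- move=> t _ /=; rewrite subrr mul0r /wrapped_parabola /parabola !mul0r disc_pt0.
  rewrite /boundary_path -yx; move: (y - x) => d.
  by rewrite /x disc_xE addrAC circle_pt_period.
- move=> u u01 /=; have [h1 h2] := c'P u u01.
  have [gc g0 g1] := simp c (lexx _) (ltW c0).
  by rewrite g0 g1; exact: simp.
- move=> u t u01 t01; have [h1 h2] := c'P u u01.
  have /andP[] := parabola_height_le h2 (cyx _ h1 h2) t01.
  rewrite /punctured_disc /mkset /wrapped_parabola sqnorm_disc_pt.
  move: (parabola _ _ _ _).2 => v v0 v1.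
  by rewrite exprn_gt0 ?subr_gt0 //= expr_le1 // ?subr_ge0 ?lerBlDr ?lerDl // ltW.
Qed.

Definition radius i (t : R) : R * R := (t * (disc_vertex R i).1, t * (disc_vertex R i).2).

Lemma sqnorm_radius i t : sqnorm (radius i t) = t ^+ 2.
Proof.
have := sqnorm_circle_pt n ((i.+1)%:R : R).
by rewrite /sqnorm /= !exprMn -mulrDr => ->; rewrite mulr1.
Qed.

Lemma radiusE i t : radius i t = disc_pt ((i.+1)%:R, 1 - t).
Proof. by rewrite /radius /disc_pt /= subKr. Qed.

Lemma radius_rep i : disc_representative (DBridge i) (radius i).
Proof.
split.
  move=> t /andP[t0 t1]; rewrite /punctured_disc_interior /mkset sqnorm_radius.
  by rewrite exprn_gt0 //= expr_lt1 // ltW.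
split; [split| |]; last 2 first.
- by rewrite /radius !mul0r.
- by rewrite /radius !mul1r -surjective_pairing.
- apply: continuous_subspaceT.
  by apply: continuous_pair => t; apply: cvgM;
    [exact: cvg_id|exact: cvg_cst|exact: cvg_id|exact: cvg_cst].
move=> s t s0 st t1 e; have /eqP := congr1 (@sqnorm R) e.
have t0 : 0 <= t by lra.
by rewrite !sqnorm_radius eqrXn2 // => /eqP; lra.
Qed.

Lemma disc_bridges_do_not_meet i j : DBridge i <> DBridge j -> dnm (DBridge i) (DBridge j).
Proof.
move=> ij; exists (radius i), (radius j); split; try exact: radius_rep.
apply: curves_do_not_meet => s t /andP[s0 _] /andP[t0 _] e.
rewrite /punctured_disc_interior /mkset => /andP[+ _].
rewrite sqnorm_radius exprn_even_gt0 //= => sn.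
have {}s0 : 0 < s by rewrite lt_def sn s0.
have /eqP := congr1 (@sqnorm R) e; rewrite !sqnorm_radius eqrXn2 ?(ltW s0) // => /eqP st.
move: e; rewrite !radiusE => /disc_pt_eq[] /=; rewrite -?st; try lra.
move=> _ [m]; rewrite -[LHS]addr0 -(mul0r nR) => em.
have /disc_x_inj[_ eij] : disc_x 0 i = disc_x m j by rewrite !disc_xE.
by apply: ij; rewrite eij.
Qed.

(** A common point would put some lift of [i] strictly between the ends of the lifted parabola,
    which is a crossing. *)
Lemma disc_bridge_periph_do_not_meet i i1 j1 :
  ~ disc_crossing (DBridge i) (DPeriph i1 j1) -> dnm (DBridge i) (DPeriph i1 j1).
Proof.
(* All bases have length at most [n], so one coefficient serves every arc; the summand 0 gives it
   the shape that [inv1D_bound] expects. *)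
move=> ncr; pose c := (1 + nR ^+ 2 + 0)^-1.
have c0 : 0 < c by apply: inv1D_gt0; rewrite ?sqr_ge0.
have cn : c * nR ^+ 2 < 1 by apply: inv1D_bound; rewrite ?sqr_ge0.
pose x := disc_x 0 i1; pose y := disc_x (lift_end 0 i1 j1) j1.
have xy : x < y by rewrite /y disc_x_lift_end ltrDl clockwise_steps_gt0.
exists (radius i), (wrapped_parabola c x y).
split; [exact: radius_rep|exact: wrapped_parabola_rep|].
apply: curves_do_not_meet => s t s01 t01 e.
rewrite /punctured_disc_interior /mkset sqnorm_radius => sI.
have [s0 s1] : 0 < s /\ s < 1.
  case/andP: s01 sI => s0 s1; rewrite expr_lt1 // => /andP[h ->]; split=> //.
  by rewrite lt_def s0 andbT; apply: contraTneq h => ->; rewrite expr0n ltxx.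
have cyx : c * (y - x) ^+ 2 < 1 by exact: parabola_lt1.
have /andP[_ p1] := parabola_height_le (ltW c0) cyx t01.
have [|e2 [m e1]] := disc_pt_eq _ p1 (etrans (esym (radiusE i s)) e); first by rewrite /=; lra.
have t01' : 0 < t < 1 by apply: (@parabola_interior _ c _ _ _ xy t01); rewrite -e2 /=; lra.
have := parabola_x_itv c xy t01'.
have -> : (parabola c x y t).1 = disc_x (- m) i.
  by rewrite disc_xE mulrNz mulNr; move: e1 => /= ->; rewrite addrK.
rewrite !disc_x_lt => cr; apply: ncr; exists (- m), 0.
by rewrite iota_periph.
Qed.

(** A common point in the disc comes from a common point of the first parabola and the translate of
    the second by [m] periods; [parabolas_meet] then identifies their endpoints. *)
Lemma disc_periphs_do_not_meet i j i1 j1 : DPeriph i j <> DPeriph i1 j1 ->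
  ~ disc_crossing (DPeriph i j) (DPeriph i1 j1) ->
  dnm (DPeriph i j) (DPeriph i1 j1).
Proof.
move=> ne ncr; pose c := (1 + nR ^+ 2 + 0)^-1.
have c0 : 0 < c by apply: inv1D_gt0; rewrite ?sqr_ge0.
have cn : c * nR ^+ 2 < 1 by apply: inv1D_bound; rewrite ?sqr_ge0.
pose x := disc_x 0 i; pose y := disc_x (lift_end 0 i j) j.
have xy : x < y by rewrite /y disc_x_lift_end ltrDl clockwise_steps_gt0.
have cyx : c * (y - x) ^+ 2 < 1 by exact: parabola_lt1.
pose x1 := disc_x 0 i1; pose y1 := disc_x (lift_end 0 i1 j1) j1.
have xy1 : x1 < y1 by rewrite /y1 disc_x_lift_end ltrDl clockwise_steps_gt0.
have cyx1 : c * (y1 - x1) ^+ 2 < 1 by exact: parabola_lt1.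
exists (wrapped_parabola c x y), (wrapped_parabola c x1 y1).
split; try exact: wrapped_parabola_rep.
apply: curves_do_not_meet => s t s01 t01 e.
have /andP[p0 p1] := parabola_height_le (ltW c0) cyx s01.
have /andP[q0 q1] := parabola_height_le (ltW c0) cyx1 t01.
rewrite /punctured_disc_interior /mkset /wrapped_parabola sqnorm_disc_pt => /andP[_ sI].
have {}p0 : 0 < (parabola c x y s).2.
  by move: sI; rewrite expr_lt1 ?subr_ge0 ?ltW // gtrBl.
have [e2 [m e1]] := disc_pt_eq p1 q1 e.
have s01' := parabola_interior xy s01 p0.
have t01' : 0 < t < 1 by apply: (@parabola_interior _ c _ _ _ xy1 t01); rewrite -e2.
have hx := parabola_x_itv c xy s01'.
have hx1 := parabola_x_itv c xy1 t01'.
move: e2; rewrite !parabola_y => /mulfI; rewrite gt_eqF // => /(_ isT).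
have xm k' i' : disc_x k' i' + m%:~R * nR = disc_x (k' + m) i'.
  by rewrite !disc_xE intrD mulrDl addrA.
have hm : disc_x m i1 < (parabola c x y s).1 < disc_x (lift_end m i1 j1) j1.
  have -> : disc_x m i1 = x1 + m%:~R * nR by rewrite xm add0r.
  have -> : disc_x (lift_end m i1 j1) j1 = y1 + m%:~R * nR.
    by rewrite xm /lift_end; case: ifP; rewrite ?add0r // addrC.
  by rewrite e1 !ltrD2r.
have -> : ((parabola c x1 y1 t).1 - x1) * (y1 - (parabola c x1 y1 t).1) =
    ((parabola c x y s).1 - disc_x m i1) *
    (disc_x (lift_end m i1 j1) j1 - (parabola c x y s).1).
  have -> : disc_x m i1 = x1 + m%:~R * nR by rewrite xm add0r.
  have -> : disc_x (lift_end m i1 j1) j1 = y1 + m%:~R * nR.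
    by rewrite xm /lift_end; case: ifP; rewrite ?add0r // addrC.
  by rewrite e1; ring.
move=> ey.
have ncr' : ~~ strip_crossing (iota_arc 0 (DPeriph i j)) (iota_arc m (DPeriph i1 j1)).
  by apply/negP => cr; apply: ncr; exists 0, m.
move: ncr'; rewrite !iota_periph /= -!disc_x_lt => ncr'.
have [/disc_x_inj[_ ei] /disc_x_inj[_ ej]] := parabolas_meet hx hm ey ncr'.
by apply: ne; rewrite ei ej.
Qed.

End DiscCompatibility.

(** * Crossing disc arcs meet, by lifting to the universal cover *)

Section DiscCrossings.
Local Open Scope ring_scope.
Variables (R : realType) (n : nat).
Hypothesis n_gt0 : (0 < n)%N.
Implicit Types (g h : R -> R * R) (i j : 'I_n) (k l : int).

Notation nR := (n%:R : R).
Notation dnm := (do_not_meet (@disc_representative R n) (@punctured_disc_interior R)).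

Lemma continuous_sqnorm_within g : {within `[0, 1], continuous g} ->
  continuous (fun t => sqnorm (g (clamp t))).
Proof.
move=> /continuous_within_unit cg; have := continuous_dot cg cg.
by rewrite (_ : (fun t => dot _ _) = fun t => sqnorm (g (clamp t))).
Qed.

Lemma sqnorm_disc_vertex i : sqnorm (disc_vertex R i) = 1.
Proof. exact: sqnorm_circle_pt. Qed.

Lemma periph_rep_cases i j g : disc_representative (DPeriph i j) g ->
  forall t, 0 <= t <= 1 -> [\/ t = 0, t = 1 | 0 < sqnorm (g t) < 1].
Proof.
move=> [gi _] t /andP[]; rewrite le_eqVlt => /orP[/eqP<- _|t0].
  exact: Or31.
rewrite le_eqVlt => /orP[/eqP->|t1]; first exact: Or32.
by apply: Or33; apply: gi; rewrite t0 t1.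
Qed.

Lemma periph_rep_sqnorm i j g : disc_representative (DPeriph i j) g ->
  forall t, 0 <= t <= 1 -> 0 < sqnorm (g t) <= 1.
Proof.
move=> gr t t01; have [_ [[_ g0 g1] _]] := gr.
case: (periph_rep_cases gr t01) => [->|->|/andP[-> /ltW ->]//].
  by rewrite g0 sqnorm_disc_vertex ltr01 lexx.
by rewrite g1 sqnorm_disc_vertex ltr01 lexx.
Qed.

(* A lift of g to the universal cover of the punctured disc, whose point
   (x, y) lies over the point of square norm 1 - y on the ray of circle_pt x. *)
Definition cover_curve (f : R -> R) g k (t : R) : R * R :=
  (f t + k%:~R * nR, 1 - sqnorm (g (clamp t))).

Lemma continuous_cover_curve f g k :
  continuous f -> {within `[0, 1], continuous g} -> continuous (cover_curve f g k).
Proof.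
move=> cf cg; apply: continuous_pair => t.
  by apply: cvgD; [exact: cf|exact: cvg_cst].
by apply: cvgB; [exact: cvg_cst|exact: continuous_sqnorm_within].
Qed.

Lemma cover_curve_meet f g k f' h l s t :
  0 <= s <= 1 -> 0 <= t <= 1 ->
  on_ray n (f s) (g s) -> on_ray n (f' t) (h t) ->
  cover_curve f g k s = cover_curve f' h l t -> g s = h t.
Proof.
move=> s01 t01 /(on_ray_period n_gt0 k) fg /(on_ray_period n_gt0 l) fh [].
rewrite !clamp_id // => e1 /addrI/oppr_inj e2.
by apply: (on_ray_inj _ fh) e2; rewrite -e1.
Qed.

Lemma periph_cover_curve i j g k : disc_representative (DPeriph i j) g ->
  exists f : R -> R, [/\ continuous (cover_curve f g k),
    cover_curve f g k 0 = (disc_x R k i, 0),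
    cover_curve f g k 1 = (disc_x R (lift_end k i j) j, 0) &
    forall t, 0 <= t <= 1 -> on_ray n (f t) (g t)].
Proof.
move=> gr; have [f [cf f0 f1 fg]] := periph_lifting n_gt0 gr.
have [gi [[[cg _] g0 g1] _]] := gr.
exists f; split=> //; first exact: continuous_cover_curve.
  by rewrite /cover_curve clamp_id ?lexx ?ler01 // g0 sqnorm_disc_vertex subrr f0 disc_xE.
rewrite /cover_curve clamp_id ?lexx ?ler01 // g1 sqnorm_disc_vertex subrr f1.
by rewrite disc_x_lift_end disc_xE addrAC.
Qed.

(** [crossing_arcs] applies to the lifts by [k] and [l]. Their common point is interior, because no
    end of one lift is an end of the other, even if the arcs share a vertex of the disc. *)
Lemma disc_periphs_do_not_meet_noncrossing i j k i1 j1 l :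
  dnm (DPeriph i j) (DPeriph i1 j1) ->
  ~~ ((pos k i < pos l i1 < pos (lift_end k i j) j) &&
      (pos (lift_end k i j) j < pos (lift_end l i1 j1) j1)).
Proof.
move=> [g [h [gr hr e]]]; apply/negP; rewrite -!(disc_x_lt R) => /andP[cr bd].
have [f [cf f0 f1 fg]] := periph_cover_curve k gr.
have [f' [cf' f'0 f'1 fh]] := periph_cover_curve l hr.
have pos_y i' j' f'' g' k' t : disc_representative (DPeriph i' j') g' ->
    0 <= t <= 1 -> 0 <= (cover_curve f'' g' k' t).2.
  by move=> gr' t01; rewrite /= clamp_id // subr_ge0; case/andP: (periph_rep_sqnorm gr' t01).
have [t t01|t t01|s [t [s01 t01 st]]] :=
    crossing_arcs (continuous_subspaceT cf) (continuous_subspaceT cf') f0 f1 f'0 f'1 cr bd.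
- exact: pos_y gr t01.
- exact: pos_y hr t01.
have gh := cover_curve_meet s01 t01 (fg _ s01) (fh _ t01) st.
apply: (curves_meet e s01 t01 gh); rewrite /punctured_disc_interior /mkset.
have hcase : 0 < sqnorm (g s) < 1 \/ t = 0 \/ t = 1.
  by rewrite gh; case: (periph_rep_cases hr t01); auto.
have [ac cb] := andP cr; have ad := lt_trans ac (lt_trans cb bd).
case: (periph_rep_cases gr s01) => // se; case: hcase => // -[] te; exfalso;
  move: st; rewrite se te ?f0 ?f1 ?f'0 ?f'1 => -[] xe.
- by move: ac; rewrite xe ltxx.
- by move: ad; rewrite xe ltxx.
- by move: cb; rewrite xe ltxx.
- by move: bd; rewrite xe ltxx.
Qed.

(** A curve has no angle at the puncture, so only a tail of a bridging curve can be lifted; [d]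
    bounds how far from the puncture the tail starts. *)
Lemma bridge_tail j h d : disc_representative (DBridge j) h -> 0 < d ->
  exists2 t0, 0 < t0 < 1 & sqnorm (h t0) < d.
Proof.
move=> [hi [[ch _] h0 h1]] d0; have cs := continuous_sqnorm_within ch.
have s0 : sqnorm (h (clamp 0)) < d.
  by rewrite clamp_id ?lexx ?ler01 // h0 /sqnorm /= expr0n addr0.
have near0 : \forall t \near 0^'+, sqnorm (h (clamp t)) < d.
  apply: cvg_within; exact: (cvgr_lt _ (cs 0) _ s0).
have nearP : \forall t \near (0 : R)^'+, [/\ sqnorm (h (clamp t)) < d, 0 < t & t < 1].
  near=> t; split; first by near: t; exact: near0.
    by near: t; exact: nbhs_right_gt.
  by near: t; exact: nbhs_right_lt.
have [t [ht t0 t1]] := @filter_ex _ _ (at_right_proper_filter 0) _ nearP.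
exists t; first by rewrite t0 t1.
by move: ht; rewrite clamp_id // !ltW.
Unshelve. all: by end_near. Qed.

(** By compactness [g] stays away from the puncture. A tail of [h] that starts closer to it lifts to
    a curve starting above the whole lift of [g], as [crossing_bridge] requires. *)
Lemma disc_bridge_periph_do_not_meet_noncrossing i k i1 j1 l :
  dnm (DBridge i) (DPeriph i1 j1) ->
  ~~ (pos l i1 < pos k i < pos (lift_end l i1 j1) j1).
Proof.
move=> [h [g [hr gr e]]]; apply/negP; rewrite -!(disc_x_lt R) => cr.
have [f [cf f0 f1 fg]] := periph_cover_curve l gr.
have [gi [[[cg _] g0 g1] _]] := gr; have [hi [[ch _] h0 h1]] := hr.
have cs := continuous_sqnorm_within cg.
have [c c01 cmin] := EVT_min ler01 (continuous_subspaceT cs).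
rewrite in_itv /= in c01.
have [t0 t001 ht0] := bridge_tail hr (proj1 (andP (periph_rep_sqnorm gr c01))).
pose tail (t : R) := t0 + t * (1 - t0).
have tail01 t : 0 <= t <= 1 -> 0 < tail t <= 1 by move=> t01; rewrite /tail; nra.
have ctail : continuous tail.
  by move=> t; apply: cvgD; [exact: cvg_cst|apply: cvgM; [exact: cvg_id|exact: cvg_cst]].
have tail0 : tail 0 = t0 by rewrite /tail mul0r addr0.
have tail1 : tail 1 = 1 by rewrite /tail mul1r addrC subrK.
pose K t := h (clamp (tail t)).
have KE t : 0 <= t <= 1 -> K t = h (tail t).
  by move=> /tail01 /andP[? ?]; rewrite /K clamp_id // ltW.
have cK : continuous K.
  move=> t; apply: (@continuous_comp _ _ _ tail (h \o @clamp R)); first exact: ctail.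
  exact: continuous_within_unit.
have hcase t : 0 <= t <= 1 -> 0 < sqnorm (K t) < 1 \/ t = 1.
  move=> t01; rewrite KE //; have /andP[tl tg] := tail01 t t01.
  have [t1|] := eqVneq t 1; first by right.
  move=> t1; left; apply: hi; rewrite tl /tail /=.
  have : t < 1 by rewrite lt_neqAle t1; case/andP: t01.
  by nra.
have i1' : 0 <= (1 : R) <= 1 by rewrite lexx ler01.
have i0' : 0 <= (0 : R) <= 1 by rewrite lexx ler01.
have K1 : K 1 = disc_vertex R i by rewrite KE // tail1.
have Ksq t : 0 <= t <= 1 -> 0 < sqnorm (K t) <= 1.
  move=> /hcase[/andP[-> /ltW ->]//|->].
  by rewrite K1 sqnorm_disc_vertex ltr01 lexx.
have [|| f' [cf' f'1 fK]] := path_lifting n_gt0 (x := (i.+1)%:R) (continuous_subspaceT cK).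
- by move=> t /Ksq /andP[? _]; exact: sqnorm_gt0.
- by rewrite K1; exact: on_ray_circle_pt.
have cH := @continuous_cover_curve f' K k cf' (continuous_subspaceT cK).
have H1 : cover_curve f' K k 1 = (disc_x R k i, 0).
  by rewrite /cover_curve clamp_id // K1 sqnorm_disc_vertex subrr f'1 disc_xE.
have [t t01|t t01|s [t [s01 t01 st]]] :=
    crossing_bridge (continuous_subspaceT cf) (continuous_subspaceT cH) f0 f1 H1 cr.
- rewrite /= !clamp_id // KE // tail0 lerD2l lerN2 subr_ge0.
  case/andP: (periph_rep_sqnorm gr t01) => _ -> /=.
  have := cmin t; rewrite in_itv /= !clamp_id // => /(_ t01).
  exact/le_trans/ltW.
- by rewrite /= clamp_id // subr_ge0; case/andP: (Ksq _ t01).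
have gh := cover_curve_meet s01 t01 (fg _ s01) (fK _ t01) st.
have tl : 0 <= tail t <= 1 by case/andP: (tail01 _ t01) => /ltW -> ->.
apply: (curves_meet e tl s01); rewrite -KE // -gh // /punctured_disc_interior /mkset.
have [ac cb] := andP cr.
case: (periph_rep_cases gr s01) => // se; case: (hcase _ t01); rewrite -?gh // => te;
  exfalso; move: st; rewrite se te ?f0 ?f1 H1 => -[] xe.
- by move: ac; rewrite xe ltxx.
- by move: cb; rewrite xe ltxx.
Qed.

Theorem disc_do_not_meetP (a b : disc_arc n) : a <> b ->
  dnm a b <-> ~ disc_crossing a b.
Proof.
move=> ne; split.
  move=> h [k [l]]; move: h; case: a b {ne} => [i|i j] [i1|i1 j1] h //.
  - by rewrite iota_periph; apply/negP; exact: disc_bridge_periph_do_not_meet_noncrossing.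
  - rewrite iota_periph; apply/negP; apply: disc_bridge_periph_do_not_meet_noncrossing.
    exact/do_not_meetC.
  rewrite !iota_periph; apply/negP; rewrite negb_or.
  by rewrite !disc_periphs_do_not_meet_noncrossing //; exact/do_not_meetC.
case: a b ne => [i|i j] [i1|i1 j1] ne ncr.
- exact: disc_bridges_do_not_meet.
- exact: disc_bridge_periph_do_not_meet.
- apply/do_not_meetC/disc_bridge_periph_do_not_meet => // -[k [l]].
  by rewrite strip_crossingC => cr; apply: ncr; exists l, k.
- exact: disc_periphs_do_not_meet.
Qed.

End DiscCrossings.

(** * Triangulations as maximal non-crossing sets *)

Section MaximalNoncrossing.

Definition noncrossing_maximal (A : Type) (arcs : set A) (C : A -> A -> Prop)
    (T : set A) : Prop :=
  T `<=` arcs /\ (forall a, arcs a -> T a <-> (forall b, T b -> ~ C a b)).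

(** Compatibility is pairwise, so maximality can be tested by adding one arc at a time. An arc of
    [T] is also tested against itself, which is why [C] has to be irreflexive. *)
Lemma maximal_compatibleP (A : Type) (arcs : set A) (dnm C : A -> A -> Prop) T :
  (forall a b, arcs a -> arcs b -> a <> b -> dnm a b <-> ~ C a b) ->
  (forall a, ~ C a a) -> (forall a b, C a b -> C b a) ->
  maximal_compatible_collection arcs dnm T <-> noncrossing_maximal arcs C T.
Proof.
move=> dC Cn Cs; split.
  move=> [[Ta Tc] Tm]; split=> // a aa; split=> [Taa b Tb|h].
    have [->//|ne] := pselect (a = b).
    by apply/dC => //; [exact: Ta|exact: Tc].
  suff <- : T `|` [set a] = T by right.
  apply: Tm; last by move=> x; left.
  split=> [x [/Ta//|->//]|x y [Tx|->] [Ty|->] // ne]; first exact: Tc.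
    by apply/dC => //; [exact: Ta|move=> /Cs; exact: h].
  by apply/dC => //; [exact: Ta|exact: h].
move=> [Ta Tm]; split; first split=> // a b Taa Tb ne.
  by apply/dC; [exact: Ta|exact: Ta| |exact: (Tm a (Ta a Taa)).1].
move=> T' [T'a T'c] TT'; apply/seteqP; split=> // a T'aa.
apply/(Tm _ (T'a _ T'aa)) => b Tb; have [->//|ne] := pselect (a = b).
by apply/dC => //; [exact: T'a|exact/T'a/TT'|apply: T'c => //; exact: TT'].
Qed.

End MaximalNoncrossing.

(** * Integer positions and lifts of disc arcs *)

Section StripCombinatorics.
Local Open Scope ring_scope.
Variable n : nat.
Implicit Types (i j : 'I_n) (k l m z : int) (a b : strip_arc n) (c : disc_arc n).

Lemma shift_iota m k c : shift_arc m (iota_arc k c) = iota_arc (k + m) c.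
Proof. by case: c => [j|i j] //=; case: ifP => //= _; rewrite addrAC. Qed.

Lemma iota_arcK k : cancel (iota_arc k) (@proj_arc n).
Proof. by case=> [j|i j] //=; case: ifP. Qed.

Lemma strip_crossing_shift m a b :
  strip_crossing (shift_arc m a) (shift_arc m b) = strip_crossing a b.
Proof. by case: a b => [? ?|? ? ? ?] [? ?|? ? ? ?] //=; rewrite !posD !ltrD2r. Qed.

(** Crossing is invariant under translating both lifts, so the lift of [c] can be prescribed. *)
Lemma disc_crossing_at k c c' : disc_crossing c c' ->
  exists l, strip_crossing (iota_arc k c) (iota_arc l c').
Proof.
move=> [k0 [l0]]; rewrite -(strip_crossing_shift (k - k0)) !shift_iota addrC subrK => cr.
by exists (l0 + (k - k0)).
Qed.

Lemma exists_pos_between z j : exists m, z < pos m j <= z + n%:Z.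
Proof.
have hj := ltn_ord j; have n0 : n%:Z != 0 by lia.
(* The quotient is raised by one because the interval is open at its left end [z]. *)
exists (((z - (j : nat)%:Z) %/ n%:Z)%Z + 1); rewrite /pos.
have := divz_eq (z - (j : nat)%:Z) n%:Z.
have := modz_ge0 (z - (j : nat)%:Z) n0.
have : ((z - (j : nat)%:Z) %% n%:Z)%Z < n%:Z by apply: ltz_pmod; lia.
rewrite mulrDl mul1r; move: (_ %/ _)%Z (_ %% _)%Z => q r.
by move: (q * n%:Z) => qn; lia.
Qed.

Lemma pos_surj z : (0 < n)%N -> exists k i, pos k i = z.
Proof.
move=> n_gt0; have n0 : n%:Z != 0 by lia.
have r0 := modz_ge0 z n0; have rn : (z %% n%:Z)%Z < n%:Z by apply: ltz_pmod; lia.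
have hi : (`|(z %% n%:Z)%Z| < n)%N by lia.
exists (z %/ n%:Z)%Z, (Ordinal hi); rewrite /pos /= [RHS](divz_eq z n%:Z); lia.
Qed.

(** Positions exhaust the integers, so lower vertices are neighbours exactly when their positions
    differ by 1. *)
Lemma strip_arcsP k i l j : strip_arcs (SPeriph k i l j) <-> pos k i + 2 <= pos l j.
Proof.
have n_gt0 : (0 < n)%N by have := ltn_ord i; lia.
rewrite /strip_arcs /lower_neighbours /= lower_lt_pos; split.
  move=> [lt nn]; have [m [h [h1 h2]]] : exists m h, lower_lt k i m h /\ lower_lt m h l j.
    by apply: contrapT => ne; apply: nn.
  by rewrite !lower_lt_pos in h1 h2; lia.
move=> h; split; first lia; case=> _; apply.
have [m [q e]] := pos_surj (pos k i + 1) n_gt0.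
by exists m, q; rewrite !lower_lt_pos e; lia.
Qed.

Lemma clockwise_steps_eq1 i j : clockwise_steps i j = 1%N <-> j = ordS i.
Proof.
have hi := ltn_ord i; have hj := ltn_ord j.
have -> : (j = ordS i) <-> (nat_of_ord j = (i.+1 %% n)%N).
  by split=> [->//|e]; exact: val_inj.
rewrite /clockwise_steps; have [i1|i1] := ltnP i.+1 n.
  by rewrite modn_small //; case: (ltnP i j) => ij; split; lia.
have -> : (i.+1 %% n = 0)%N by rewrite (_ : i.+1 = n) ?modnn; lia.
by case: (ltnP i j) => ij; split; lia.
Qed.

Lemma iota_arc_arcs k c : strip_arcs (iota_arc k c) <-> disc_arcs c.
Proof.
case: c => [j//|i j]; rewrite iota_periph; split=> [/strip_arcsP|h]; last first.
  apply/strip_arcsP; rewrite pos_lift_end lerD2l.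
  have /andP[s0 _] := clockwise_steps_bounds i j.
  suff : clockwise_steps i j <> 1%N by lia.
  by move=> /clockwise_steps_eq1.
by rewrite pos_lift_end lerD2l /= => h /clockwise_steps_eq1 e; rewrite e in h.
Qed.

(** The right ends of the two arcs both lie among the [n] integers following [pos k i], and they
    differ by a multiple of [n]. *)
Lemma short_periph_iota k i l j : pos k i < pos l j <= pos k i + n%:Z ->
  SPeriph k i l j = iota_arc k (DPeriph i j).
Proof.
rewrite iota_periph => h; congr SPeriph.
have := pos_lift_end k i j; move: (lift_end k i j) => l' e.
have /andP[s0 s1] := clockwise_steps_bounds i j.
have : `|pos l j - pos l' j| < n%:Z by rewrite e; lia.
rewrite /pos opprD addrACA subrr addr0 -mulrBl => hn.
have hi := ltn_ord i.
have : l - l' = 0.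
  apply/eqP; apply: contraTT hn => ll; rewrite -leNgt normrM.
  by rewrite ler_peMl // -gtz0_ge1 normr_gt0.
by move/eqP; rewrite subr_eq0 => /eqP.
Qed.

Lemma polygon_vertex_lower k i l j :
  polygon_vertex (k, i) (Lower l j) <-> pos k i <= pos l j <= pos k i + n%:Z.
Proof.
have <- : pos (k + 1) i = pos k i + n%:Z by rewrite posD mul1r.
rewrite !leNgt -!lower_lt_pos /lower_lt /=; split; first by lia.
have : l < k \/ l = k \/ l = k + 1 \/ k + 1 < l by lia.
by case=> [|[->|[->|]]]; lia.
Qed.

Lemma disc_crossingC c c' : disc_crossing c c' -> disc_crossing c' c.
Proof. by move=> [k [l]]; rewrite strip_crossingC => cr; exists l, k. Qed.

(** Two crossing lifts would be intervals of one length, at most [n], shifted by a nonzero amount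
    less than that length; but lifts differ by multiples of [n]. *)
Lemma disc_crossing_refl c : ~ disc_crossing c c.
Proof.
move=> [k [l]]; case: c => [//|i j].
rewrite !iota_periph /= !pos_lift_end /pos.
have /andP[s0 s1] := clockwise_steps_bounds i j; move: (clockwise_steps i j) s0 s1 => s s0 s1.
have hn : (l - k) * n%:Z <= - n%:Z \/ (l - k) * n%:Z = 0 \/ n%:Z <= (l - k) * n%:Z.
  have : l - k <= -1 \/ l - k = 0 \/ 1 <= l - k by lia.
  by case=> [|[->|]]; [left|right; left|right; right]; nia.
by move: hn; rewrite mulrBl; move: (l * _) (k * _) => x y; lia.
Qed.

Lemma proj_Phi (Pi : set (disc_arc n)) : @proj_arc n @` Phi Pi = Pi.
Proof.
apply/seteqP; split=> [_ [_ [k _ [c Pc <-]] <-]|c Pc]; first by rewrite iota_arcK.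
by exists (iota_arc 0 c); [exists 0 => //; exists c|rewrite iota_arcK].
Qed.

(** Without peripheral arcs, any bridging arc belongs to [Pi]. Otherwise the left end of a longest
    one works: an arc passing over it starts earlier and is not longer, so it ends earlier and
    crosses the longest arc. *)
Lemma bridge_in_triangulation (Pi : set (disc_arc n)) : (0 < n)%N ->
  noncrossing_maximal (@disc_arcs n) (@disc_crossing n) Pi -> exists j, Pi (DBridge j).
Proof.
move=> n_gt0 [Pa Pm].
have [[[i0 j0] /= P0]|none] :=
  pselect (exists p : 'I_n * 'I_n, Pi (DPeriph p.1 p.2)); last first.
  exists (Ordinal n_gt0); apply/Pm => // -[i|i j] Pb [k [l]] //.
  by case: none; exists (i, j).
have P0' : `[< Pi (DPeriph (i0, j0).1 (i0, j0).2) >] by apply/asboolP.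
case: (@arg_maxnP _ (i0, j0) (fun p => `[< Pi (DPeriph p.1 p.2) >])
  (fun p => clockwise_steps p.1 p.2) P0') => -[i j] /= /asboolP Pij maxij.
exists i; apply/Pm => // -[i1|i1 j1] Pb [k [l]] //; rewrite iota_periph /= => cr.
have /(_ _ Pb) ncr := (Pm _ (Pa _ Pij)).1 Pij.
have ms : (clockwise_steps i1 j1 <= clockwise_steps i j)%N.
  by apply: (maxij (i1, j1)); exact/asboolP.
apply: ncr; exists k, l; rewrite !iota_periph /= cr /=.
by move: cr; rewrite !pos_lift_end; lia.
Qed.

End StripCombinatorics.

(** * The two maps on maximal non-crossing sets *)

Section PeriodicTriangulations.
Local Open Scope ring_scope.
Variable n : nat.
Implicit Types (i j : 'I_n) (k l m z : int) (a b : strip_arc n) (c : disc_arc n)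
  (Pi : set (disc_arc n)) (T : set (strip_arc n)) (P : int * 'I_n).

Notation disc_maximal := (noncrossing_maximal (@disc_arcs n) (@disc_crossing n)).
Notation strip_maximal :=
  (noncrossing_maximal (@strip_arcs n) (fun a b => strip_crossing a b)).

Lemma strip_maximal_Phi Pi : (0 < n)%N -> disc_maximal Pi -> strip_maximal (Phi Pi).
Proof.
move=> n_gt0 dPi; have [j Pj] := bridge_in_triangulation n_gt0 dPi.
have [Pa Pm] := dPi; split; first by move=> _ [k _ [c /Pa ca <-]]; apply/iota_arc_arcs.
have iotaP k c : strip_arcs (iota_arc k c) ->
    (forall b, Phi Pi b -> ~ strip_crossing (iota_arc k c) b) -> Phi Pi (iota_arc k c).
  move=> /iota_arc_arcs ca h; exists k => //; exists c => //.
  apply/(Pm _ ca) => c' Pc' /(disc_crossing_at k)[l]; apply: h.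
  by exists l => //; exists c'.
move=> a aa; split.
  move=> [k _ [c Pc <-]] _ [l _ [c' Pc' <-]] cr.
  by apply: ((Pm _ (Pa _ Pc)).1 Pc _ Pc'); exists k, l.
case: a aa => [k i|k i l i1] aa h; first exact: (iotaP k (DBridge i)).
(* This is the first lift of [j] to the right of the left end. An arc that does not cross the
   bridging arc there ends no later, so its length is at most [n]. *)
have [m /andP[m1 m2]] := exists_pos_between (pos k i) j.
have ncr : ~ strip_crossing (SPeriph k i l i1) (SBridge m j).
  by apply: h; exists m => //; exists (DBridge j).
have le2 := (strip_arcsP _ _ _ _).1 aa.
have short : pos k i < pos l i1 <= pos k i + n%:Z by move: ncr; rewrite /=; lia.
by move: aa h; rewrite (short_periph_iota short); exact: iotaP.
Qed.

Lemma disc_maximal_Phi Pi : strip_maximal (Phi Pi) -> disc_maximal Pi.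
Proof.
move=> [Ta Tm].
have inP k c : Phi Pi (iota_arc k c) <-> Pi c.
  split=> [Pc|Pc]; last by exists k => //; exists c.
  by rewrite -(proj_Phi Pi); exists (iota_arc k c); rewrite ?iota_arcK.
have Pa : Pi `<=` @disc_arcs n.
  by move=> c Pc; apply/(iota_arc_arcs 0)/Ta/inP.
split=> // c ca; split.
  move=> Pc c' Pc' [k [l]]; have Pkc := (inP k c).2 Pc.
  by apply: ((Tm _ (Ta _ Pkc)).1 Pkc); exact/inP.
move=> h; apply/(inP 0)/(Tm _ ((iota_arc_arcs 0 c).2 ca)) => _ [l _ [c' Pc' <-]] cr.
by apply: (h _ Pc'); exists 0, l.
Qed.

(** The lifts of the bridging arc at [j] cut the strip into translates of one polygon. As no lift of
    an arc of [Pi] crosses them, each arc has a lift inside the polygon. *)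
Lemma fundamental_domain_Phi Pi j : disc_maximal Pi -> Pi (DBridge j) ->
  fundamental_domain (Phi Pi) (0, j).
Proof.
move=> [Pa Pm] Pj; have bridgeP m : Phi Pi (SBridge m j).
  by exists m => //; exists (DBridge j).
split=> //; apply/seteqP; split; last first.
  move=> _ [m _ [_ [[k _ [c Pc <-]] _] <-]]; rewrite shift_iota.
  by exists (k + m) => //; exists c.
move=> _ [k _ [c Pc <-]].
suff [m cP] : exists m, in_polygon (0, j) (iota_arc (k - m) c).
  exists m => //; exists (iota_arc (k - m) c); last by rewrite shift_iota subrK.
  by split=> //; exists (k - m) => //; exists c.
case: c Pc => [i|i i1] Pc.
  have [ji|ij] := leqP j i.
    by exists k; rewrite subrr; split=> /=; left.
  by exists (k - 1); rewrite subKr; split; right; rewrite // ltnW.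
have [m /andP[m1 m2]] := exists_pos_between (pos k i) j.
have ncr : ~ disc_crossing (DPeriph i i1) (DBridge j) by exact: (Pm _ (Pa _ Pc)).1.
have h : pos (lift_end k i i1) i1 <= pos m j.
  by rewrite leNgt; apply/negP => h; apply: ncr; exists k, m; rewrite iota_periph /= m1.
(* The arc lies between the bridging arcs at the lifts [m - 1] and [m] of [j]; a translation moves
   these to 0 and 1. *)
exists (m - 1); rewrite -shift_iota iota_periph.
have s0 : pos k i <= pos (lift_end k i i1) i1 by rewrite pos_lift_end lerDl.
have pj : pos m j = pos 0 j + m * n%:Z by rewrite -posD add0r.
by split; apply/polygon_vertex_lower; rewrite posD mulNr mulrBl mul1r; lia.
Qed.

(** The lower side of the polygon has length [n], so its peripheral arcs are short enough to be
    lifts of disc arcs. *)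
Lemma in_polygon_iota T P a : T `<=` @strip_arcs n -> T a -> in_polygon P a ->
  exists k, a = iota_arc k (proj_arc a).
Proof.
case: P => k0 i0 Ta; case: a => [k i|k i l j] aT [hl hr]; first by exists k.
exists k; apply: short_periph_iota.
have := (strip_arcsP _ _ _ _).1 (Ta _ aT).
move: hl hr => /polygon_vertex_lower + /polygon_vertex_lower.
by rewrite /=; lia.
Qed.

Lemma Phi_Psi_at T P : T `<=` @strip_arcs n -> fundamental_domain T P ->
  Phi (Psi_at P T) = T.
Proof.
move=> Ta [_ _ TE]; apply/seteqP; split.
  move=> _ [k _ [_ [a [aT aP] <-] <-]].
  have [k0 e] := in_polygon_iota Ta aT aP.
  rewrite TE; exists (k - k0) => //; exists a => //.
  by rewrite [in LHS]e shift_iota addrC subrK.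
move=> x; rewrite {1}TE => -[m _ [a [aT aP] <-]].
have [k0 e] := in_polygon_iota Ta aT aP.
exists (k0 + m) => //; exists (proj_arc a); first by exists a.
by rewrite [in RHS]e shift_iota.
Qed.

(** The right-hand side does not depend on [P]; this makes [Psi] independent of the fundamental
    domain. *)
Lemma Psi_atE T P : T `<=` @strip_arcs n -> fundamental_domain T P ->
  Psi_at P T = @proj_arc n @` T.
Proof. by move=> Ta fd; rewrite -[in RHS](Phi_Psi_at Ta fd) proj_Phi. Qed.

Lemma PsiE T P : T `<=` @strip_arcs n -> fundamental_domain T P ->
  Psi T = Psi_at P T.
Proof.
move=> Ta fd; apply/seteqP; split; last by move=> c Pc; exists P.
by move=> c [Q fdQ]; rewrite (Psi_atE Ta fd) (Psi_atE Ta fdQ).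
Qed.

End PeriodicTriangulations.

(** * Transfer to topological triangulations *)

Section Triangulations.
Local Open Scope ring_scope.
Variables (R : realType) (n : nat).
Hypothesis n_gt0 : (0 < n)%N.

Lemma disc_triangulationP (Pi : set (disc_arc n)) : disc_triangulation R Pi <->
  noncrossing_maximal (@disc_arcs n) (@disc_crossing n) Pi.
Proof.
apply: maximal_compatibleP.
- by move=> a b _ _; exact: disc_do_not_meetP.
- exact: disc_crossing_refl.
- exact: disc_crossingC.
Qed.

Lemma strip_triangulationP (T : set (strip_arc n)) : strip_triangulation R T <->
  noncrossing_maximal (@strip_arcs n) (fun a b => strip_crossing a b) T.
Proof.
apply: maximal_compatibleP.
- by move=> a b aa ba ne; rewrite strip_do_not_meetP //; split=> /negP.
- by move=> a; rewrite strip_crossing_refl.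
- by move=> a b; rewrite strip_crossingC.
Qed.

Lemma periodic_Phi Pi : disc_triangulation R Pi ->
  periodic_strip_triangulation R (@Phi n Pi).
Proof.
move=> /disc_triangulationP dPi; split.
  exact/strip_triangulationP/strip_maximal_Phi.
have [j Pj] := bridge_in_triangulation n_gt0 dPi.
by exists (0, j); exact: fundamental_domain_Phi.
Qed.

Lemma periodic_PsiE T P : @periodic_strip_triangulation R n T ->
  fundamental_domain T P -> Psi T = Psi_at P T.
Proof. by move=> [/strip_triangulationP[Ta _] _]; exact: PsiE. Qed.

Lemma Phi_PsiK T : @periodic_strip_triangulation R n T -> Phi (Psi T) = T.
Proof.
move=> pT; have [/strip_triangulationP[Ta _] [P fd]] := pT.
by rewrite (periodic_PsiE pT fd) Phi_Psi_at.
Qed.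

Lemma triangulation_Psi T : @periodic_strip_triangulation R n T ->
  disc_triangulation R (Psi T).
Proof.
move=> pT; apply/disc_triangulationP/disc_maximal_Phi; rewrite Phi_PsiK //.
by case: pT => /strip_triangulationP.
Qed.

Lemma Psi_PhiK Pi : disc_triangulation R Pi -> Psi (@Phi n Pi) = Pi.
Proof.
move=> /periodic_Phi pT; have [/strip_triangulationP[Ta _] [P fd]] := pT.
by rewrite (periodic_PsiE pT fd) (Psi_atE Ta fd) proj_Phi.
Qed.

End Triangulations.

(* The first clause says that the value of Psi is computed by any choice of a
   fundamental domain. *)
Theorem theorem4p13 (R : realType) (n : nat) (n_ge1 : (1 <= n)%N) :
  [/\ (forall (T : set (strip_arc n)) (P : int * 'I_n),
         @periodic_strip_triangulation R n T -> fundamental_domain T P ->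
         Psi T = Psi_at P T),
      set_bij (@disc_triangulation R n) (@periodic_strip_triangulation R n)
        (@Phi n),
      set_bij (@periodic_strip_triangulation R n) (@disc_triangulation R n)
        (@Psi n),
      (forall Pi : set (disc_arc n), @disc_triangulation R n Pi ->
         Psi (Phi Pi) = Pi) &
      (forall T : set (strip_arc n), @periodic_strip_triangulation R n T ->
         Phi (Psi T) = T)].
Proof.
split.
- exact: periodic_PsiE.
- split; first exact: periodic_Phi.
    move=> Pi Pi' /set_mem dPi /set_mem dPi' e.
    by rewrite -(Psi_PhiK n_ge1 dPi) e (Psi_PhiK n_ge1 dPi').
  move=> T pT; exists (Psi T); [exact: triangulation_Psi|exact: (Phi_PsiK pT)].
- split; first exact: triangulation_Psi.
    move=> T T' /set_mem pT /set_mem pT' e.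
    by rewrite -(Phi_PsiK pT) e (Phi_PsiK pT').
  move=> Pi dPi; exists (Phi Pi); [exact: periodic_Phi|exact: (Psi_PhiK n_ge1 dPi)].
- by move=> Pi dPi; exact: (Psi_PhiK n_ge1 dPi).
- by move=> T pT; exact: (Phi_PsiK pT).
Qed.
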